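(* Assume that $J$ is locally partly smooth at $x_0$ relative to $\mathcal{M}$ and that there exists $\tilde\Gamma\in\mathbb{R}^{p\times p}$ such that $$\ker(\tilde\Gamma)\cap T=\{0\}\quad\text{and}\quad \eta_{\tilde\Gamma}\in\mathrm{ri}(\partial J(x_0)).$$ Then there exists a constant $C>0$ such that if $$\max\left(\|\Gamma-\tilde\Gamma\|,\ \|\varepsilon\|\mu^{-1},\ \mu\right)\le C,$$ the solution $x_\theta$ of $(\mathcal{P}_\theta)$ is unique and satisfies $$x_\theta\in\mathcal{M}\quad\text{and}\quad \|x_\theta-x_0\|=O(\|\varepsilon\|).$$
   Context: Observation model and canonical parameters: $y=\Phi x_0+w$, where $x_0\in\mathbb{R}^p$ is the vector to recover, $\Phi\in\mathbb{R}^{n\times p}$ is the design matrix and $w\in\mathbb{R}^n$ is the noise. Here $\Phi$ and $w$ are fixed and deterministic. $J:\mathbb{R}^p\to\mathbb{R}$ is a positive, convex, finite-valued function, and $\lambda>0$ is a regularization parameter. The canonical parameters are $\theta=(\mu,u,\Gamma)=\left(\frac{\lambda}{n},\frac{\Phi^*y}{n},\frac{\Phi^*\Phi}{n}\right)$, and $\varepsilon=\frac{\Phi^*w}{n}=u-\Gamma x_0$. It is assumed, without loss of generality, that $y\in\mathrm{Im}(\Phi)$, and thus $u\in\mathrm{Im}(\Gamma)$. Problem $(\mathcal{P}_\theta)$: $$\min_{x\in\mathbb{R}^p}\ J(x)+\frac{1}{2\mu}\langle\Gamma x,x\rangle-\frac1\mu\langle x,u\rangle+\frac{1}{2\mu}\langle\Gamma^+u,u\rangle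 ,$$ where $A^+$ is the Moore–Penrose pseudo-inverse of a matrix $A$. This is a rewriting of the problem of minimizing $J(x)+\frac{1}{2\lambda}\|\Phi x-y\|^2$ over $x\in\mathbb{R}^p$. Notation: $\partial J$ is the convex subdifferential, and $\mathrm{ri}$ denotes the relative interior of a convex set (its interior for the topology of its affine hull). For a convex set $\mathcal{C}\subset\mathbb{R}^p$, $\mathrm{VecHull}(\mathcal{C})=\{\rho(x-x'):(x,x')\in\mathcal{C}^2,\ \rho\in\mathbb{R}\}$. The tangent model subspace at $x$ is $T_x=\mathrm{VecHull}(\partial J(x))^\perp$. For a linear space $T$, $P_T$ is the orthogonal projection onto $T$, and for a matrix $\Gamma\in\mathbb{R}^{p\times p}$, $\Gamma_T=P_T\Gamma P_T$. Throughout, $T=T_{x_0}$ and $e=P_T(\partial J(x_0))\in\mathbb{R}^p$ (the projection onto $T$ of any element of $\partial J(x_0)$; it does not depend on the element). For a matrix $\tilde\Gamma\in\mathbb{R}^{p\times p}$ with $\ker(\tilde\Gamma)\cap T=\{0\}$, the linearized pre-certificate is $\eta_{\tilde\Gamma}=\tilde\Gamma\,\tilde\Gamma_T^+e$, where $\tilde\Gamma_T^+$ is the pseudo-inverse of $\tilde\Gamma_T=P_T\tilde\Gamma P_T$. Partial smoothness: a finite-valued convex function $J$ is partly smooth at $x$ relative to a set $\mathcal{M}$ containing $x$ if (i) $\mathcal{M}$ is a $C^2$-manifold around $x$ and $J$ restricted to $\mathcal{M}$ is $C^2$ around $x$; (ii) the tangent space of $\mathcal{M}$ at $x$ is $T_x$;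 (iii) the set-valued mapping $\partial J$ is continuous at $x$ relative to $\mathcal{M}$. $J$ is locally partly smooth at $x$ relative to a set $\mathcal{M}$ if $\mathcal{M}$ is a manifold and there exists a neighbourhood $U$ of $x$ such that $J$ is partly smooth at each point $x'\in\mathcal{M}\cap U$ relative to $\mathcal{M}$.
   Formalization: The rate ‖x_θ − x_0‖ = O(‖ε‖) is proved only for μ ≤ κ‖ε‖ (any fixed κ, with the O-constant depending on κ, C not), since without this it fails: J=|·|, x_0=Φ=1, w=0 gives x_θ=1−λ with ε=0. *)

(* Defs.v *)
(* R^p is represented by column vectors 'cV[R]_p over an abstract R : realType. *)
From mathcomp Require Export all_boot all_order all_algebra.
From mathcomp Require Export all_classical all_reals all_analysis.
Export Order.TTheory GRing.Theory Num.Theory.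
Export numFieldNormedType.Exports.

Set Implicit Arguments.
Unset Strict Implicit.
Unset Printing Implicit Defensive.

#[global] Open Scope classical_set_scope.
#[global] Open Scope ring_scope.

Definition dotp (R : realType) (m : nat) (x y : 'cV[R]_m) : R :=
  \sum_i x i 0 * y i 0.

(* The library norm `|x| on matrices is the max norm, so the Euclidean norm is
   introduced separately; both induce the same topology. *)
Definition l2norm (R : realType) (m : nat) (x : 'cV[R]_m) : R :=
  Num.sqrt (dotp x x).

Definition opnorm (R : realType) (m n : nat) (A : 'M[R]_(m, n)) : R :=
  sup [set l2norm (A *m x) | x in [set x | l2norm x <= 1]].

(* The four Penrose equations determine B uniquely; [pinvmx] of mxalgebra is
   only some generalized inverse. *)
Definition is_pseudo_inverse (R : realType) (m n : nat)
    (A : 'M[R]_(m, n)) (B : 'M[R]_(n, m)) : Prop :=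
  [/\ A *m B *m A = A, B *m A *m B = B,
      (A *m B)^T = A *m B & (B *m A)^T = B *m A].

Definition pseudo_inverse (R : realType) (m n : nat)
    (A : 'M[R]_(m, n)) : 'M[R]_(n, m) :=
  xget 0 [set B | is_pseudo_inverse A B].

Definition orthogonal_compl (R : realType) (p : nat) (S : set 'cV[R]_p) :
    set 'cV[R]_p :=
  [set v | forall s, S s -> dotp s v = 0].

Definition is_orth_proj (R : realType) (p : nat)
    (T : set 'cV[R]_p) (P : 'M[R]_p) : Prop :=
  forall x, T (P *m x) /\ orthogonal_compl T (x - P *m x).

(* Meaningful when T is a linear subspace: the projector is then unique. *)
Definition orth_proj (R : realType) (p : nat) (T : set 'cV[R]_p) : 'M[R]_p :=
  xget 0 [set P | is_orth_proj T P].

Definition affine_hull (R : realType) (p : nat) (A : set 'cV[R]_p) :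
    set 'cV[R]_p :=
  [set z | exists (k : nat) (a : 'I_k -> R) (s : 'I_k -> 'cV[R]_p),
     [/\ forall i, A (s i), \sum_i a i = 1 & z = \sum_i a i *: s i]].

Definition relint (R : realType) (p : nat) (A : set 'cV[R]_p) :
    set 'cV[R]_p :=
  [set z | A z /\ exists2 U, nbhs z U & U `&` affine_hull A `<=` A].

Definition vechull (R : realType) (p : nat) (A : set 'cV[R]_p) :
    set 'cV[R]_p :=
  [set v | exists x x' (rho : R), [/\ A x, A x' & v = rho *: (x - x')]].

Definition subdiff (R : realType) (p : nat) (J : 'cV[R]_p -> R)
    (x : 'cV[R]_p) : set 'cV[R]_p :=
  [set eta | forall z, J x + dotp eta (z - x) <= J z].

(* T_x *)
Definition model_space (R : realType) (p : nat) (J : 'cV[R]_p -> R)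
    (x : 'cV[R]_p) : set 'cV[R]_p :=
  orthogonal_compl (vechull (subdiff J x)).

(* e = P_T(subdiff J x); for convex J the image is a singleton. *)
Definition model_vector (R : realType) (p : nat) (J : 'cV[R]_p -> R)
    (x : 'cV[R]_p) : 'cV[R]_p :=
  xget 0 [set orth_proj (model_space J x) *m eta | eta in subdiff J x].

(* eta_G = G G_T^+ e, where G_T = P_T G P_T *)
Definition precertificate (R : realType) (p : nat) (J : 'cV[R]_p -> R)
    (x : 'cV[R]_p) (G : 'M[R]_p) : 'cV[R]_p :=
  let P := orth_proj (model_space J x) in
  G *m pseudo_inverse (P *m G *m P) *m model_vector J x.

(* C^k on an open subset D of R^m, by iterated directional derivatives: in
   finite dimension, existence and continuity on D of all iterated directional
   derivatives of order at most k is C^k regularity in the Frechet sense. *)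
Fixpoint Ck_on (R : realType) (m : nat) (W : normedModType R) (k : nat)
    (D : set 'cV[R]_m) (f : 'cV[R]_m -> W) : Prop :=
  (forall w, D w -> {for w, continuous f}) /\
  if k is k'.+1 then
    forall v, (forall w, D w -> derivable f w v) /\ Ck_on k' D ('D_v f)
  else True.

(* phi restricted to the open set D is a C^2 immersion and a homeomorphism onto
   a relatively open subset of M containing x = phi 0. *)
Definition local_param (R : realType) (p m : nat) (M : set 'cV[R]_p)
    (x : 'cV[R]_p) (D : set 'cV[R]_m) (phi : 'cV[R]_m -> 'cV[R]_p) : Prop :=
  [/\ open D, D 0, phi 0 = x, Ck_on 2 D phi &
      (forall w v, D w -> 'D_v phi w = 0 -> v = 0) /\
      exists (U : set 'cV[R]_p) (psi : 'cV[R]_p -> 'cV[R]_m),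
        [/\ open U, phi @` D = M `&` U, {within M `&` U, continuous psi} &
            forall w, D w -> psi (phi w) = w]].

Definition C2_manifold_at (R : realType) (p : nat) (M : set 'cV[R]_p)
    (x : 'cV[R]_p) : Prop :=
  exists (m : nat) (D : set 'cV[R]_m) (phi : 'cV[R]_m -> 'cV[R]_p),
    local_param M x D phi.

Definition C2_manifold (R : realType) (p : nat) (M : set 'cV[R]_p) : Prop :=
  forall x, M x -> C2_manifold_at M x.

(* The restriction of J to M is C^2 around x, read in a local
   parametrization. *)
Definition C2_restriction_at (R : realType) (p : nat) (J : 'cV[R]_p -> R)
    (M : set 'cV[R]_p) (x : 'cV[R]_p) : Prop :=
  exists (m : nat) (D : set 'cV[R]_m) (phi : 'cV[R]_m -> 'cV[R]_p),
    local_param M x D phi /\ Ck_on 2 D (J \o phi : 'cV[R]_m -> R^o).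

(* Velocities at x of differentiable curves drawn on M. *)
Definition tangent_space (R : realType) (p : nat) (M : set 'cV[R]_p)
    (x : 'cV[R]_p) : set 'cV[R]_p :=
  [set v | exists gamma : R -> 'cV[R]_p,
     [/\ gamma 0 = x, \forall t \near (0 : R), M (gamma t) &
         is_derive (0 : R) 1 gamma v]].

(* Painleve-Kuratowski outer and inner limits of F at x relative to A. *)
Definition outer_limit (R : realType) (p q : nat)
    (F : 'cV[R]_p -> set 'cV[R]_q) (A : set 'cV[R]_p) (x : 'cV[R]_p) :
    set 'cV[R]_q :=
  [set v | forall U V, nbhs x U -> nbhs v V ->
     exists x', [/\ A x', U x' & F x' `&` V !=set0]].

Definition inner_limit (R : realType) (p q : nat)
    (F : 'cV[R]_p -> set 'cV[R]_q) (A : set 'cV[R]_p) (x : 'cV[R]_p) :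
    set 'cV[R]_q :=
  [set v | forall V, nbhs v V ->
     \forall x' \near within A (nbhs x), F x' `&` V !=set0].

Definition setvalued_continuous (R : realType) (p q : nat)
    (F : 'cV[R]_p -> set 'cV[R]_q) (A : set 'cV[R]_p) (x : 'cV[R]_p) : Prop :=
  outer_limit F A x `<=` F x /\ F x `<=` inner_limit F A x.

Definition partly_smooth (R : realType) (p : nat) (J : 'cV[R]_p -> R)
    (M : set 'cV[R]_p) (x : 'cV[R]_p) : Prop :=
  [/\ M x,
      C2_manifold_at M x /\ C2_restriction_at J M x,
      tangent_space M x = model_space J x &
      setvalued_continuous (subdiff J) M x].

(* Partial smoothness at x presupposes x \in M; without the first clause the
   last one could hold vacuously. *)
Definition locally_partly_smooth (R : realType) (p : nat)
    (J : 'cV[R]_p -> R) (M : set 'cV[R]_p) (x : 'cV[R]_p) : Prop :=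
  [/\ M x, C2_manifold M &
      exists2 U, nbhs x U & forall x', M x' -> U x' -> partly_smooth J M x'].

Definition objective (R : realType) (p : nat) (J : 'cV[R]_p -> R)
    (mu : R) (u : 'cV[R]_p) (G : 'M[R]_p) (x : 'cV[R]_p) : R :=
  J x + (2 * mu)^-1 * dotp (G *m x) x - mu^-1 * dotp x u
      + (2 * mu)^-1 * dotp (pseudo_inverse G *m u) u.

Definition solutions (R : realType) (p : nat) (J : 'cV[R]_p -> R)
    (mu : R) (u : 'cV[R]_p) (G : 'M[R]_p) : set 'cV[R]_p :=
  [set x | forall z, objective J mu u G x <= objective J mu u G z].

(* Main.v *)
(* Minimize the energy over M only, in a local parametrization phi with
   phi 0 = x0; write L = D phi(0) and g for the gradient of J o phi at 0.
   Comparing the minimizer phi h with x0 and using that G is coercive on the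
   range T of L gives |h| = O(mu), which is already the rate. The first-order
   condition says that eta = zeta - G (phi h - x0) / mu, with zeta = eps / mu,
   has the same component along the tangent space of M at phi h as the
   subgradients there; letting the parameters tend to their limits in
   eta = - G L (h / mu) + o(1) and L^T eta = g + o(1) forces eta to be close to
   the linearized pre-certificate. Since the latter is in the relative interior
   of the subdifferential at x0 and the subdifferential is inner semicontinuous
   along M, eta cannot be separated from the subdifferential at phi h by a
   vector which is normal to M or in the kernel of G: hence eta is a
   subgradient, phi h is a global minimizer, and it is the only one.

   No case is lost by taking Gt symmetric positive semidefinite: otherwise no
   G = Phi^T Phi / n is close to Gt. Uniformity over all data is obtained from
   compactness of spheres and balls in the form [compact_near_coveringP]. *)
Require Import Defs.
From mathcomp Require Import ring lra.

Set Implicit Arguments.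
Unset Strict Implicit.
Unset Printing Implicit Defensive.

(** * Matrices and inner product *)

Section MatrixAnalysis.
Context {R : realType}.

Lemma cvg_mxP {T : Type} {F : set_system T} {FF : Filter F} (m n : nat)
    (f : T -> 'M[R]_(m, n)) (A : 'M[R]_(m, n)) :
  f @ F --> A <-> forall i j, f x i j @[x --> F] --> A i j.
Proof.
split=> [fA i j|fA].
  exact: (continuous_cvg _ (@coord_continuous _ _ _ i j A) fA).
move=> U [P AP PU]; rewrite nbhs_filterE.
apply: (@filterS _ _ _ [set x | forall i j, P i j (f x i j)]).
  by move=> x Px; exact: PU.
by apply: filter_forall => i; apply: filter_forall => j; exact: fA.
Qed.

Lemma cvg_mulmx {T : Type} {F : set_system T} {FF : Filter F} (m n q : nat)
    (f : T -> 'M[R]_(m, n)) (g : T -> 'M[R]_(n, q))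
    (A : 'M[R]_(m, n)) (B : 'M[R]_(n, q)) :
  f @ F --> A -> g @ F --> B -> f x *m g x @[x --> F] --> A *m B.
Proof.
move=> /cvg_mxP fA /cvg_mxP gB; apply/cvg_mxP => i k.
rewrite mxE; under eq_fun do rewrite mxE.
by apply: (@cvg_big _ _ +%R) => [|j _]; [exact: add_continuous|exact: cvgM].
Qed.

Lemma cvg_trmx {T : Type} {F : set_system T} {FF : Filter F} (m n : nat)
    (f : T -> 'M[R]_(m, n)) (A : 'M[R]_(m, n)) :
  f @ F --> A -> (f x)^T @[x --> F] --> A^T.
Proof.
move=> /cvg_mxP fA; apply/cvg_mxP => i j.
rewrite mxE; under eq_fun do rewrite mxE.
exact: fA.
Qed.

Lemma dotpE m (x y : 'cV[R]_m) : dotp x y = (x^T *m y) 0 0.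
Proof. by rewrite mxE; apply: eq_bigr => i _; rewrite mxE. Qed.

Lemma cvg_dotp {T : Type} {F : set_system T} {FF : Filter F} (m : nat)
    (f g : T -> 'cV[R]_m) (a b : 'cV[R]_m) :
  f @ F --> a -> g @ F --> b -> dotp (f x) (g x) @[x --> F] --> dotp a b.
Proof.
move=> fa gb; rewrite dotpE; under eq_fun do rewrite dotpE.
exact: ((cvg_mxP _ _).1 (cvg_mulmx (cvg_trmx fa) gb)).
Qed.

Lemma dotpC m (x y : 'cV[R]_m) : dotp x y = dotp y x.
Proof. by rewrite /dotp; apply: eq_bigr => i _; exact: mulrC. Qed.

Lemma dotpDr m (x y z : 'cV[R]_m) : dotp x (y + z) = dotp x y + dotp x z.
Proof. by rewrite !dotpE mulmxDr mxE. Qed.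

Lemma dotpNr m (x y : 'cV[R]_m) : dotp x (- y) = - dotp x y.
Proof. by rewrite !dotpE mulmxN mxE. Qed.

Lemma dotpBr m (x y z : 'cV[R]_m) : dotp x (y - z) = dotp x y - dotp x z.
Proof. by rewrite dotpDr dotpNr. Qed.

Lemma dotpZr m a (x y : 'cV[R]_m) : dotp x (a *: y) = a * dotp x y.
Proof. by rewrite !dotpE -scalemxAr mxE. Qed.

Lemma dotpDl m (x y z : 'cV[R]_m) : dotp (x + y) z = dotp x z + dotp y z.
Proof. by rewrite !(dotpC _ z) dotpDr. Qed.

Lemma dotpNl m (x y : 'cV[R]_m) : dotp (- x) y = - dotp x y.
Proof. by rewrite !(dotpC _ y) dotpNr. Qed.

Lemma dotpBl m (x y z : 'cV[R]_m) : dotp (x - y) z = dotp x z - dotp y z.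
Proof. by rewrite !(dotpC _ z) dotpBr. Qed.

Lemma dotpZl m a (x y : 'cV[R]_m) : dotp (a *: x) y = a * dotp x y.
Proof. by rewrite !(dotpC _ y) dotpZr. Qed.

Definition dotpL := (dotpDl, dotpBl, dotpZl, dotpNl, dotpDr, dotpBr, dotpZr, dotpNr).

Lemma dotp0r m (x : 'cV[R]_m) : dotp x 0 = 0.
Proof. by rewrite dotpE mulmx0 mxE. Qed.

Lemma dotp0l m (x : 'cV[R]_m) : dotp 0 x = 0.
Proof. by rewrite dotpC dotp0r. Qed.

Lemma dotp_mull m n (A : 'M[R]_(m, n)) x y : dotp (A *m x) y = dotp x (A^T *m y).
Proof. by rewrite !dotpE trmx_mul mulmxA. Qed.

Lemma dotp_ge0 m (x : 'cV[R]_m) : 0 <= dotp x x.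
Proof. by apply: sumr_ge0 => i _; rewrite -expr2 sqr_ge0. Qed.

Lemma dotp_eq0 m (x : 'cV[R]_m) : dotp x x = 0 -> x = 0.
Proof.
move=> /eqP; rewrite psumr_eq0 => [/allP x0|i _]; last by rewrite -expr2 sqr_ge0.
apply/colP => i; rewrite mxE; apply/eqP.
by have := x0 i (mem_index_enum _); rewrite -expr2 sqrf_eq0.
Qed.

Lemma dotp_gt0 m (x : 'cV[R]_m) : x != 0 -> 0 < dotp x x.
Proof.
by move=> x0; rewrite lt_def dotp_ge0 andbT; apply: contra_neq x0 => /dotp_eq0.
Qed.

Lemma ler_mx_norm_coef m n (A : 'M[R]_(m, n)) i j : `|A i j| <= `|A|.
Proof.
rewrite [leRHS]/Num.Def.normr/= mx_normrE.
exact: (le_bigmax _ (fun ij => `|A ij.1 ij.2|) (i, j)).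
Qed.

Lemma mx_norm_le m n (A : 'M[R]_(m, n)) a :
  0 <= a -> (forall i j, `|A i j| <= a) -> `|A| <= a.
Proof.
move=> a0 Aa; rewrite [leLHS]/Num.Def.normr/= mx_normrE.
by apply: bigmax_le => // -[i j] _; exact: Aa.
Qed.

Lemma dotp_norm_le m (x y : 'cV[R]_m) : `|dotp x y| <= m%:R * `|x| * `|y|.
Proof.
apply: le_trans (ler_norm_sum _ _ _) _.
apply: (@le_trans _ _ (\sum_(i < m) `|x| * `|y|)).
  by apply: ler_sum => i _; rewrite normrM ler_pM ?ler_mx_norm_coef.
by rewrite sumr_const card_ord -mulrA mulr_natl.
Qed.

Lemma mulmx_norm_le m n q (A : 'M[R]_(m, n)) (B : 'M[R]_(n, q)) :
  `|A *m B| <= n%:R * `|A| * `|B|.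
Proof.
apply: mx_norm_le => [|i j]; first by rewrite !mulr_ge0.
rewrite mxE; apply: le_trans (ler_norm_sum _ _ _) _.
apply: (@le_trans _ _ (\sum_(i < n) `|A| * `|B|)).
  by apply: ler_sum => k _; rewrite normrM ler_pM ?ler_mx_norm_coef.
by rewrite sumr_const card_ord -mulrA mulr_natl.
Qed.

Lemma mx_norm_tr m n (A : 'M[R]_(m, n)) : `|A^T| = `|A|.
Proof.
apply/eqP; rewrite eq_le; apply/andP; split; apply: mx_norm_le => // i j.
  by rewrite mxE ler_mx_norm_coef.
by have := ler_mx_norm_coef A^T j i; rewrite mxE.
Qed.

(** Heine-Borel for row vectors carries over to columns, as transposition is continuous and
    preserves the norm. *)
Lemma cV_bounded_closed_compact m (A : set 'cV[R]_m) r :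
  (forall x, A x -> `|x| <= r) -> closed A -> compact A.
Proof.
move=> Ar Acl.
have tr_cont k l : continuous (@trmx R k l).
  by move=> x; exact: (@cvg_trmx _ (nbhs x) _ _ _ id x (@cvg_id _ _)).
have -> : A = trmx @` (trmx @^-1` A : set 'rV[R]_m).
  rewrite eqEsubset; split=> [x Ax|_ [y Ay <-]//].
  by exists x^T; rewrite /= ?trmxK.
apply: continuous_compact; first by apply: continuous_subspaceT => x; exact: tr_cont.
apply: bounded_closed_compact; last first.
  by refine (preimage_closed _ Acl) => x _; exact: tr_cont.
exists r; split; first exact: num_real.
by move=> s rs y /= /Ar; rewrite mx_norm_tr => yr; exact: le_trans yr (ltW rs).
Qed.

Lemma compact_cV_closed_ball m r : compact [set x : 'cV[R]_m | `|x| <= r].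
Proof.
apply: (@cV_bounded_closed_compact _ _ r) => //.
by refine (preimage_closed _ (@closed_le _ r)) => x _; exact: norm_continuous.
Qed.

Lemma compact_cV_sphere m : compact [set x : 'cV[R]_m | `|x| = 1].
Proof.
apply: (@cV_bounded_closed_compact _ _ 1) => [x ->//|].
by refine (preimage_closed _ (@closed_eq _ 1)) => x _; exact: norm_continuous.
Qed.

(** Compactness as uniformity: local neighbourhoods of the points of [K] are merged into one
    condition on [i]. The estimates that are uniform in the data rest on it. *)
Lemma compact_near {I : Type} {F : set_system I} {FF : Filter F} m
    (K : set 'cV[R]_m) (P : I -> 'cV[R]_m -> Prop) :
  compact K ->
  (forall x, K x -> \forall z \near filter_prod (nbhs x) F, P z.2 z.1) ->
  \forall i \near F, forall x, K x -> P i x.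
Proof. by move=> /compact_near_coveringP; exact. Qed.

End MatrixAnalysis.

(** * Differentiability from continuous partial derivatives *)

Section PartialDerivatives.
Context {R : realType}.

(** The mean value theorem on the segment from [z] to [z + t *: v], for [t] of either sign. *)
Lemma MVT_direction (V : normedModType R) (f : V -> R) (z v : V) (t a e : R) :
  (forall s : R, `|s| <= `|t| -> derivable f (z + s *: v) v) ->
  (forall s : R, `|s| <= `|t| -> `|'D_v f (z + s *: v) - a| <= e) ->
  `|f (z + t *: v) - f z - t * a| <= e * `|t|.
Proof.
move=> df dfa; pose g (s : R) := f (z + s *: v).
have dg (s : R) : `|s| <= `|t| -> is_derive s (1 : R) g ('D_v f (z + s *: v)).
  move=> st; have := df s st; rewrite /derivable /derive.
  set q1 := (X in cvg (X @ _)); set q2 := (X in is_derive _ _ _ (lim (X @ _))).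
  move=> cq; have qE : (fun h : R => h^-1 *: ((g \o shift s) (h *: 1) - g s)) = q1.
    apply/funext => h; rewrite /q1 /g /= [h *: 1]mulr1.
    by congr (_ *: (f _ - _)); rewrite scalerDl addrCA.
  by split; rewrite /derivable /derive qE.
suff [c ct gc] : exists2 c : R, `|c| <= `|t| & g t - g 0 = 'D_v f (z + c *: v) * t.
  have -> : f (z + t *: v) - f z = 'D_v f (z + c *: v) * t.
    by rewrite -gc /g scale0r addr0.
  by rewrite (mulrC t) -mulrBl normrM ler_wpM2r// dfa.
have [t0|t0|<-] := ltgtP 0 t; last by exists 0; rewrite ?subrr ?mulr0 ?normr0.
- have ct c : c \in `[0, t] -> `|c| <= `|t|.
    by rewrite in_itv/= => /andP[c0 ct]; rewrite !ger0_norm ?(ltW t0).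
  have [c /subset_itv_oo_cc c0t gc] := MVT t0
    (fun x xt => dg x (ct x (subset_itv_oo_cc xt)))
    (derivable_within_continuous
      (fun x xt => @ex_derive _ _ _ _ _ _ _ (dg x (ct x xt)))).
  by exists c; rewrite ?ct// gc subr0.
- have ct c : c \in `[t, 0] -> `|c| <= `|t|.
    by rewrite in_itv/= => /andP[c0 ct]; rewrite !ler0_norm ?lerN2// ltW.
  have [c /subset_itv_oo_cc c0t gc] := MVT t0
    (fun x xt => dg x (ct x (subset_itv_oo_cc xt)))
    (derivable_within_continuous
      (fun x xt => @ex_derive _ _ _ _ _ _ _ (dg x (ct x xt)))).
  exists c; rewrite ?ct// -opprB gc; ring.
Qed.

Definition base_vec m (j : 'I_m) : 'cV[R]_m := delta_mx j 0.

(** The vertices of a path from 0 to [h] that changes one coordinate at a time; in the max norm it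
    stays in the ball through [h]. *)
Definition head_vec m k (h : 'cV[R]_m) : 'cV[R]_m :=
  \col_i (if (i < k)%N then h i 0 else 0).

Lemma head_vecS m (k : 'I_m) (h : 'cV[R]_m) :
  head_vec k.+1 h = head_vec k h + h k 0 *: base_vec k.
Proof.
apply/colP => i; rewrite !mxE eqxx andbT ltnS leq_eqVlt -val_eqE /=.
have [/val_inj->|_] /= := eqVneq (i : nat) k;
  by rewrite ?ltnn ?mulr1 ?mulr0 ?add0r ?addr0.
Qed.

Lemma norm_head_vec_line m (k : 'I_m) (h : 'cV[R]_m) s :
  `|s| <= `|h k 0| -> `|head_vec k h + s *: base_vec k| <= `|h|.
Proof.
move=> sh; apply: mx_norm_le => // i j; rewrite ord1 !mxE eqxx andbT.
have [->|ik] := eqVneq i k.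
  by rewrite ltnn mulr1 add0r (le_trans sh)// ler_mx_norm_coef.
by rewrite mulr0 addr0; case: ifP => _; rewrite ?normr0 ?ler_mx_norm_coef.
Qed.

(** Continuous partial derivatives give Frechet differentiability: the increment is split along the
    coordinate path, and each piece is compared with its partial derivative by the mean value
    theorem. *)
Lemma C1_differentiable_scalar m (f : 'cV[R]_m -> R) (e : R) :
  (\forall h \near (0 : 'cV[R]_m), forall j, derivable f h (base_vec j)) ->
  (forall j, {for 0, continuous ('D_(base_vec j) f)}) ->
  0 < e ->
  \forall h \near (0 : 'cV[R]_m),
    `|f h - f 0 - \sum_j h j 0 * 'D_(base_vec j) f 0| <= e * `|h|.
Proof.
(* Dividing by [m.+1] rather than [m] keeps [e'] positive when [m = 0]. *)
move=> df cf e0; pose e' := e / m.+1%:R.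
have e'0 : 0 < e' by rewrite divr_gt0.
have : \forall h \near (0 : 'cV[R]_m), forall j,
    `|'D_(base_vec j) f 0 - 'D_(base_vec j) f h| <= e'.
  have cfj j : \forall h \near (0 : 'cV[R]_m),
      `|'D_(base_vec j) f 0 - 'D_(base_vec j) f h| <= e'.
    by move/cvgrPdist_le : (cf j) => /(_ _ e'0).
  exact: (filter_forall _ cfj).
move=> /(filterI df) /nbhs_normP [r /= r0 rP]; apply/nbhs_normP; exists r => //= h.
rewrite /ball_ /= sub0r normrN => hr.
have hP x : `|x| <= `|h| -> (forall j, derivable f x (base_vec j)) /\
    forall j, `|'D_(base_vec j) f 0 - 'D_(base_vec j) f x| <= e'.
  by move=> xh; apply: rP; rewrite /ball_ /= sub0r normrN (le_lt_trans xh).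
have -> : f h - f 0 = \sum_(k < m) (f (head_vec k.+1 h) - f (head_vec k h)).
  rewrite -(big_mkord xpredT (fun k => f (head_vec k.+1 h) - f (head_vec k h))).
  rewrite telescope_sumr//; congr (f _ - f _); apply/colP => i; rewrite !mxE.
    by rewrite ltn_ord.
  by [].
rewrite -sumrB; apply: le_trans (ler_norm_sum _ _ _) _.
apply: (@le_trans _ _ (\sum_(k < m) e' * `|h|)).
  apply: ler_sum => k _; rewrite head_vecS.
  apply: (@le_trans _ _ (e' * `|h k 0|)); last first.
    by rewrite ler_wpM2l ?ler_mx_norm_coef// ltW.
  apply: MVT_direction => s /norm_head_vec_line /hP[dP cP]; first exact: dP.
  by rewrite distrC cP.
rewrite sumr_const card_ord -mulr_natr.
rewrite (_ : e' * `|h| * m%:R = e * `|h| * (m%:R / m.+1%:R)); last by rewrite /e'; ring.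
by rewrite ler_piMr ?mulr_ge0 ?(ltW e0)// ler_pdivrMr// mul1r ler_nat.
Qed.

End PartialDerivatives.

(** * First-order expansions, Jacobians and tangent spaces *)

Section Expansion.
Context {R : realType}.

Definition jac p m (f : 'cV[R]_m -> 'cV[R]_p) (h : 'cV[R]_m) : 'M[R]_(p, m) :=
  \matrix_(i, j) 'D_(base_vec j) f h i 0.

(** The error of the linear expansion at 0, relative to the norm of [h]. As the inverse of 0 is 0,
    it vanishes at [h = 0], where [remainderE] then holds as well. *)
Definition remainder p m (f : 'cV[R]_m -> 'cV[R]_p) (h : 'cV[R]_m) : 'cV[R]_p :=
  `|h|^-1 *: (f h - f 0 - jac f 0 *m h).

Lemma remainderE p m (f : 'cV[R]_m -> 'cV[R]_p) h :
  f h = f 0 + (jac f 0 *m h + `|h| *: remainder f h).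
Proof.
have [->|h0] := eqVneq h 0; first by rewrite normr0 scale0r mulmx0 !addr0.
rewrite scalerA divff ?normr_eq0// scale1r.
by rewrite [jac f 0 *m h + _]addrC subrK addrC subrK.
Qed.

Lemma remainder0 p m (f : 'cV[R]_m -> 'cV[R]_p) : remainder f 0 = 0.
Proof. by rewrite /remainder normr0 invr0 scale0r. Qed.

Definition C1_at p m (f : 'cV[R]_m -> 'cV[R]_p) :=
  (\forall h \near (0 : 'cV[R]_m), forall j, derivable f h (base_vec j)) /\
  (forall j, {for 0, continuous ('D_(base_vec j) f)}).

Lemma C1_jac_cvg p m (f : 'cV[R]_m -> 'cV[R]_p) :
  C1_at f -> jac f h @[h --> (0 : 'cV[R]_m)] --> jac f 0.
Proof.
move=> [_ cf]; apply: ((@cvg_mxP _ _ (nbhs (0 : 'cV[R]_m)) _ _ _ _ _).2) => i j.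
rewrite mxE; under eq_fun do rewrite mxE.
exact: ((cvg_mxP _ _).1 (cf j) i 0).
Qed.

Lemma C1_remainder_cvg p m (f : 'cV[R]_m -> 'cV[R]_p) :
  C1_at f -> remainder f h @[h --> (0 : 'cV[R]_m)] --> (0 : 'cV[R]_p).
Proof.
move=> [df cf]; apply: ((@cvgr0Pnorm_le _ _ _ (nbhs (0 : 'cV[R]_m)) _ _).2) => e e0.
have fi (i : 'I_p) : \forall h \near (0 : 'cV[R]_m),
    `|f h i 0 - f 0 i 0 - \sum_j h j 0 * 'D_(base_vec j) (fun h => f h i 0) 0|
      <= e * `|h|.
  apply: C1_differentiable_scalar e0.
    by apply: filterS df => h dh j; exact: ((derivable_mxP _ _ _).1 (dh j)).
  move=> j; have : \forall h \near (0 : 'cV[R]_m),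
      'D_(base_vec j) f h i 0 = 'D_(base_vec j) (fun h => f h i 0) h.
    by apply: filterS df => h dh; rewrite derive_mx// mxE.
  move=> DE; rewrite /prop_for /continuous_at -(nbhs_singleton DE).
  apply: cvg_trans ((cvg_mxP _ _).1 (cf j) i 0).
  exact: near_eq_cvg DE.
have df0 := nbhs_singleton df.
apply: filterS2 df (filter_forall _ fi) => h dh {}fi.
have [->|h0] := eqVneq h 0; first by rewrite remainder0 normr0 ltW.
rewrite /remainder normrZ normfV normr_id mulrC ler_pdivrMr ?normr_gt0//.
apply: mx_norm_le => [|i j]; first by rewrite mulr_ge0// ltW.
rewrite ord1 !mxE; apply: le_trans (fi i).
rewrite le_eqVlt; apply/orP; left; apply/eqP; congr (`|_ - _|).
apply: eq_bigr => k _; by rewrite mxE mulrC derive_mx ?mxE//.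
Qed.

Lemma C1_derive0 p m (f : 'cV[R]_m -> 'cV[R]_p) v :
  C1_at f -> is_derive (0 : 'cV[R]_m) v f (jac f 0 *m v).
Proof.
move=> cf; set q := fun t : R => t^-1 *: ((f \o shift 0) (t *: v) - f 0).
have tv : (fun t : R => t *: v) t @[t --> 0^'] --> (0 : 'cV[R]_m).
  rewrite -(scale0r v); apply: cvgZr_tmp.
  exact: cvg_within.
suff qv : q t @[t --> 0^'] --> jac f 0 *m v.
  by split; [apply/cvg_ex; eexists; exact: qv|exact: cvg_lim].
have -> : jac f 0 *m v = jac f 0 *m v + 0 by rewrite addr0.
(* The quotient of the absolute value of [t] by [t] is a sign, hence bounded, so the last term tends
   to 0 from both sides. *)
have : (jac f 0 *m v + (`|t| / t * `|v|) *: remainder f (t *: v)) @[t --> 0^'] -->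
    jac f 0 *m v + 0.
  apply: cvgD; first exact: cvg_cst.
  apply/cvgr0Pnorm_le => e e0.
  have e'0 : 0 < e / (`|v| + 1) by rewrite divr_gt0// ltr_wpDl.
  have /cvgr0Pnorm_le /(_ _ e'0) := cvg_comp _ _ tv (C1_remainder_cvg cf).
  move=> rP; near=> t.
  have t0 : t != 0 by near: t; exact: nbhs_dnbhs_neq.
  have rt : `|remainder f (t *: v)| <= e / (`|v| + 1) by near: t.
  rewrite normrZ !normrM normfV !normr_id divff ?normr_eq0// mul1r.
  apply: (@le_trans _ _ (`|v| * (e / (`|v| + 1)))); first by rewrite ler_wpM2l.
  rewrite mulrCA ger_pMr// ler_pdivrMr ?mul1r ?lerDl// ltr_wpDl//.
apply: cvg_trans; apply: near_eq_cvg; near=> t.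
have t0 : t != 0 by near: t; exact: nbhs_dnbhs_neq.
rewrite /q /= addr0 [f (t *: v)]remainderE [f 0 + _]addrC addrK scalerDr.
rewrite -scalemxAr !scalerA mulVf// scale1r; congr (_ + _ *: _).
by rewrite normrZ mulrA [t^-1 * _]mulrC.
Unshelve. all: by end_near. Qed.

Lemma unitmx_ker0 m (A : 'M[R]_m) :
  (forall v : 'cV_m, A *m v = 0 -> v = 0) -> A \in unitmx.
Proof.
move=> A0; rewrite -unitmx_tr -row_free_unit -kermx_eq0; apply/eqP/row_matrixP => i.
rewrite row0; apply: trmx_inj; rewrite trmx0; apply: A0.
by rewrite -{1}[A]trmxK -trmx_mul -row_mul mulmx_ker row0 trmx0.
Qed.

Lemma gram_unit p m (L : 'M[R]_(p, m)) :
  (forall v : 'cV_m, L *m v = 0 -> v = 0) -> L^T *m L \in unitmx.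
Proof.
move=> L0; apply: unitmx_ker0 => v Lv; apply: L0; apply: dotp_eq0.
by rewrite dotp_mull mulmxA Lv dotp0r.
Qed.

Lemma left_inverse p m (L : 'M[R]_(p, m)) :
  (forall v : 'cV_m, L *m v = 0 -> v = 0) -> exists B : 'M[R]_(m, p), B *m L = 1%:M.
Proof.
move=> /gram_unit L0; exists (invmx (L^T *m L) *m L^T).
by rewrite -mulmxA mulVmx.
Qed.

Lemma Ck_on_C1 p m k (D : set 'cV[R]_m) (f : 'cV[R]_m -> 'cV[R]_p) :
  open D -> D 0 -> Ck_on k.+2 D f -> C1_at f.
Proof.
move=> oD D0 [_ fk]; split.
  apply: (filterS _ (open_nbhs_nbhs (conj oD D0))) => h Dh j.
  by have [+ _] := fk (base_vec j); exact.
by move=> j; have [_ [+ _]] := fk (base_vec j); exact.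
Qed.

Lemma local_param_jac_inj p m (M : set 'cV[R]_p) x (D : set 'cV[R]_m) phi :
  local_param M x D phi -> forall v : 'cV[R]_m, jac phi 0 *m v = 0 -> v = 0.
Proof.
move=> [oD D0 _ phiC2 [phi_inj _]] v Lv; apply: (phi_inj 0) => //; rewrite -Lv.
by have [] := C1_derive0 v (Ck_on_C1 oD D0 phiC2).
Qed.

(** The curves [phi (t *: k)] realize the range of the Jacobian. Conversely, a curve on [M] is
    lifted by [psi], which is only continuous, so the lift cannot be differentiated; instead the
    expansion of [phi] shows that the curve leaves this range by only a small fraction of its
    displacement. *)
Lemma tangent_space_param p m (M : set 'cV[R]_p) x (D : set 'cV[R]_m) phi :
  local_param M x D phi ->
  tangent_space M x = range (fun k => jac phi 0 *m k).
Proof.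
move=> /[dup] /local_param_jac_inj L0.
move=> [oD D0 phi0 phiC2 [_ [U [psi [oU phiD psi_cont psiK]]]]].
have cphi := Ck_on_C1 oD D0 phiC2.
have MUx : (M `&` U) x by rewrite -phiD -phi0; exists 0.
rewrite eqEsubset; split=> [v [gamma [g0 gM dg]]|_ [k _ <-]]; last first.
  exists (fun t => phi (t *: k)); split; first by rewrite scale0r.
    have tk : (t *: k) @[t --> (0 : R)] --> (0 : 'cV[R]_m).
      by rewrite -(scale0r k); apply: cvgZr_tmp; exact: cvg_id.
    have tD : \forall t \near (0 : R), D (t *: k).
      exact: (tk _ (open_nbhs_nbhs (conj oD D0))).
    apply: filterS tD => t Dt.
    have : (phi @` D) (phi (t *: k)) by exists (t *: k).
    by rewrite phiD => -[].
  have [+ <-] := C1_derive0 k cphi.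
  rewrite /derivable /derive; set q := (fun h : R => _) => cq.
  suff qE : (fun h : R => h^-1 *: (((fun t => phi (t *: k)) \o shift 0) (h *: 1) -
      phi (0 *: k))) = q by split; rewrite /derivable /derive qE.
  by apply/funext => h; rewrite /q /= [h *: 1]mulr1 scale0r !addr0.
have [B BL] := left_inverse L0; set L := jac phi 0 in L0 BL *.
(* [N] vanishes on the range of [L], and [N *m v = 0] means [v = L *m (B *m v)]; the norm of
   [N *m v] is shown to be at most any [e > 0]. *)
pose N := L *m B - 1%:M; have NL : N *m L = 0.
  by rewrite mulmxBl -mulmxA BL mulmx1 mul1mx subrr.
exists (B *m v) => //; apply/eqP; rewrite -subr_eq0.
rewrite mulmxA -[X in _ - X]mul1mx -mulmxBl -/N.
rewrite -normr_eq0 eq_le normr_ge0 andbT; apply/ler_addgt0Pl => e e0; rewrite addr0.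
pose b := p%:R * `|B|; pose K := p%:R * `|N| * (2 * b).
have b0 : 0 <= b by rewrite mulr_ge0.
have K0 : 0 <= K by rewrite !mulr_ge0.
(* [eta] will bound the remainder. It is chosen to satisfy both [beta] and [Kveta]. *)
pose eta := e / (e * (2 * b + 1) + (K * `|v| + 1)).
have den0 : 0 < e * (2 * b + 1) + (K * `|v| + 1).
  by rewrite addr_gt0 ?mulr_gt0 ?ltr_wpDl ?mulr_ge0.
have eta0 : 0 < eta by rewrite divr_gt0.
have beta : b * eta <= 2^-1.
  rewrite /eta mulrA ler_pdivrMr// mulrDr mulrA.
  have : 0 <= K * `|v| by rewrite mulr_ge0.
  by nra.
have Kveta : K * eta * `|v| <= e.
  rewrite mulrAC /eta mulrCA ger_pMr// ler_pdivrMr// mul1r.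
  have : 0 <= e * (2 * b + 1) by rewrite mulr_ge0 ?(ltW e0)// addr_ge0// mulr_ge0.
  by lra.
clearbody eta; apply: le_trans Kveta.
have [dg' dgv] := dg.
have gq : t^-1 *: (gamma t - x) @[t --> (0 : R)^'] --> v.
  rewrite -dgv -g0 /derive; move: dg'; rewrite /derivable.
  set q := (fun h : R => _) => cq.
  suff -> : (fun t : R => t^-1 *: (gamma t - gamma 0)) = q by [].
  by apply/funext => h; rewrite /q /= [h *: 1]mulr1 addr0.
have gx : gamma t @[t --> (0 : R)] --> x.
  rewrite -g0; apply: differentiable_continuous; exact/derivable1_diffP.
have gMU : \forall t \near (0 : R), (M `&` U) (gamma t).
  apply: filterI gM _; apply: gx; apply: open_nbhs_nbhs; split => //.
  by case: MUx.
have wcvg : psi (gamma t) @[t --> (0 : R)] --> (0 : 'cV[R]_m).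
  rewrite -(psiK _ D0) phi0.
  move=> V /(((subspace_continuousP _ _).1 psi_cont) _ MUx) psiV.
  have gV : \forall t \near (0 : R), (M `&` U) (gamma t) -> V (psi (gamma t)).
    exact: gx psiV.
  suff : \forall t \near (0 : R), V (psi (gamma t)) by [].
  by apply: filterS2 gV gMU => t; exact.
have wP : \forall t \near (0 : R), `|remainder phi (psi (gamma t))| <= eta.
  have := cvg_comp _ _ wcvg (C1_remainder_cvg cphi).
  by move=> /cvgr0Pnorm_le; apply.
have dP : \forall t \near (0 : R), `|N *m (gamma t - x)| <= K * eta * `|gamma t - x|.
  apply: filterS2 gMU wP => t; rewrite -phiD => -[h Dh <-]; rewrite psiK//.
  set r := remainder phi h => rP.
  have dE : phi h - x = L *m h + `|h| *: r.
    by rewrite [phi h]remainderE phi0 addrC addKr.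
  have hr : `| `|h| *: r| <= `|h| * eta by rewrite normrZ normr_id ler_wpM2l.
  (* The left inverse [B] bounds [h] by the displacement plus the remainder, and [beta] absorbs the
     latter into the left-hand side. *)
  have hd : `|h| <= b * (`|phi h - x| + `|h| * eta).
    rewrite -[X in `|X| <= _]mul1mx -BL -mulmxA (le_trans (mulmx_norm_le _ _))//.
    rewrite ler_wpM2l// -[L *m h](addrK (`|h| *: r)) -dE.
    by rewrite (le_trans (ler_normB _ _))// lerD2l.
  have h2 : `|h| <= 2 * b * `|phi h - x|.
    by have := normr_ge0 h; nra.
  rewrite dE mulmxDr mulmxA NL mul0mx add0r -dE (le_trans (mulmx_norm_le _ _))//.
  rewrite /K -!mulrA ler_wpM2l// ler_wpM2l//.
  apply: (le_trans hr); apply: le_trans (ler_wpM2r (ltW eta0) h2) _.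
  by rewrite le_eqVlt; apply/orP; left; apply/eqP; rewrite /b; ring.
have Nq : `|N *m (t^-1 *: (gamma t - x))| @[t --> (0 : R)^'] --> `|N *m v|.
  by apply: cvg_norm; apply: cvg_mulmx gq; exact: cvg_cst.
have Kq : K * eta * `|t^-1 *: (gamma t - x)| @[t --> (0 : R)^'] --> K * eta * `|v|.
  by apply: cvgMl_tmp; exact: cvg_norm.
apply: (ler_cvg_to Nq Kq); apply: cvg_within; apply: filterS dP => t dP.
by rewrite -scalemxAr !normrZ mulrCA ler_wpM2l.
Qed.

End Expansion.

(** * Subdifferentials and uniform first-order estimates *)

Section Subgradients.
Context {R : realType}.

Lemma subdiff_closed p (J : 'cV[R]_p -> R) x : closed (subdiff J x).
Proof.
have cz z : continuous (fun eta : 'cV[R]_p => J x + dotp eta (z - x)).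
  move=> eta; apply: (@cvgD _ _ _ (nbhs eta)); first exact: cvg_cst.
  by apply: (@cvg_dotp _ _ (nbhs eta)); [exact: cvg_id|exact: cvg_cst].
have -> : subdiff J x = \bigcap_(z in setT)
    ((fun eta => J x + dotp eta (z - x)) @^-1` [set r | r <= J z]).
  by rewrite eqEsubset; split=> eta H z; [move=> _; exact: H|exact: H].
apply: closed_bigI => z _.
by refine (preimage_closed _ (@closed_le _ _)) => eta _; exact: cz.
Qed.

Lemma subdiff_convex p (J : 'cV[R]_p -> R) x (a b : 'cV[R]_p) (t : R) :
  subdiff J x a -> subdiff J x b -> 0 <= t -> t <= 1 -> subdiff J x (a + t *: (b - a)).
Proof.
move=> Ja Jb t0 t1 z; have := Ja z; have := Jb z.
rewrite dotpDl dotpZl dotpBl; nra.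
Qed.

(* Moving from eta0 slightly away from eta stays in the subdifferential, which
   turns the inequalities into equalities. *)
Lemma relint_normal p (J : 'cV[R]_p -> R) x (eta0 v : 'cV[R]_p) :
  relint (subdiff J x) eta0 ->
  (forall eta, subdiff J x eta -> 0 <= dotp v (eta0 - eta)) ->
  model_space J x v.
Proof.
move=> [Jeta0 [U Ueta0 UJ]] v_ge0.
suff vE eta : subdiff J x eta -> dotp v eta = dotp v eta0.
  move=> _ [a [b [rho [Ja Jb ->]]]].
  by rewrite dotpC dotpZr dotpBr !vE// subrr mulr0.
move=> Jeta; have tU : (eta0 + t *: (eta0 - eta)) @[t --> (0 : R)] --> eta0.
  rewrite -[X in _ --> X]addr0 -(scale0r (eta0 - eta)).
  by apply: cvgD; [exact: cvg_cst|apply: cvgZr_tmp; exact: cvg_id].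
have /nbhs_normP [r /= r0 rU] : \forall t \near (0 : R), U (eta0 + t *: (eta0 - eta)).
  exact: tU.
have r2 : 0 < r / 2 by rewrite divr_gt0.
have Jt : subdiff J x (eta0 + (r / 2) *: (eta0 - eta)).
  apply: UJ; split.
    by apply: rU; rewrite /= sub0r normrN gtr0_norm// ltr_pdivrMr//; lra.
  exists 2%N, (fun i => if i == 0 then 1 + r / 2 else - (r / 2)),
    (fun i => if i == 0 then eta0 else eta); split.
  - by move=> i; case: ifP.
  - by rewrite !big_ord_recl big_ord0 /= addr0 addrK.
  - rewrite !big_ord_recl big_ord0 /= addr0 scalerDl scale1r scaleNr scalerBr.
    by rewrite addrA.
have := v_ge0 _ Jeta; have := v_ge0 _ Jt.
rewrite opprD addNKr dotpNr dotpZr dotpBr => h1 h2; apply/eqP; rewrite eq_le.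
by apply/andP; split; nra.
Qed.

(** * Separation from the subdifferentials along the manifold *)

Section Transversal.
Variables (p m : nat) (J : 'cV[R]_p -> R) (M : set 'cV[R]_p).
Variables (phi : 'cV[R]_m -> 'cV[R]_p) (eta0 : 'cV[R]_p) (Gt : 'M[R]_p).
Hypothesis phi_C1 : C1_at phi.
Hypothesis phi_cont : {for 0, continuous phi}.
Hypothesis phi_M : \forall h \near (0 : 'cV[R]_m), M (phi h).
Hypothesis tangentE : model_space J (phi 0) = range (fun k => jac phi 0 *m k).
Hypothesis eta0_ri : relint (subdiff J (phi 0)) eta0.
Hypothesis J_inner :
  subdiff J (phi 0) `<=` inner_limit (subdiff J) M (phi 0).
Hypothesis Gt_inj : forall v, model_space J (phi 0) v -> Gt *m v = 0 -> v = 0.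

(** By compactness of the sphere it suffices to argue near one direction [v0]. If [v0] is tangent,
    neither alternative holds in the limit, hence neither holds nearby. Otherwise the relative
    interior yields a subgradient strictly beyond [eta0] in the direction [v0], and inner
    semicontinuity carries it to nearby points of [M]. *)
Lemma normal_separation :
  \forall z \near ((0 : 'cV[R]_m), (eta0, Gt)), forall v, `|v| = 1 ->
    (jac phi z.1)^T *m v = 0 \/ z.2.2 *m v = 0 ->
    exists2 eta, subdiff J (phi z.1) eta & dotp v (z.2.1 - eta) < 0.
Proof.
have phi_within V : (\forall x \near within M (nbhs (phi 0)), V x) ->
    \forall h \near (0 : 'cV[R]_m), V (phi h).
  move=> HV; have : \forall h \near (0 : 'cV[R]_m), M (phi h) -> V (phi h).
    exact: phi_cont HV.
  by apply: filterS2 phi_M => h Mh; apply.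
apply: (@compact_near _ _ (nbhs ((0 : 'cV[R]_m), (eta0, Gt))) _ _ _
  (fun z v => (jac phi z.1)^T *m v = 0 \/ z.2.2 *m v = 0 ->
    exists2 eta, subdiff J (phi z.1) eta & dotp v (z.2.1 - eta) < 0)
  (@compact_cV_sphere _ p)) => v0 /= v01.
have v0_neq0 : v0 != 0 by rewrite -normr_eq0 v01 oner_neq0.
have [Tv0|nTv0] := pselect (model_space J (phi 0) v0).
- have Lv0 : (jac phi 0)^T *m v0 != 0.
    move: Tv0; rewrite tangentE => -[k _ kv0]; apply: contra_neq v0_neq0 => Lv0.
    by apply: dotp_eq0; rewrite -{1}kv0 dotp_mull Lv0 dotp0r.
  have Gv0 : Gt *m v0 != 0 by apply: contra_neq v0_neq0 => /(Gt_inj Tv0).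
  have Lc : (jac phi z.2.1)^T *m z.1 @[z --> (v0, ((0 : 'cV[R]_m), (eta0, Gt)))]
      --> (jac phi 0)^T *m v0.
    apply: cvg_mulmx; last exact: cvg_fst.
    apply: cvg_trmx; apply: (cvg_comp _ _ _ (C1_jac_cvg phi_C1)).
    exact: (cvg_comp _ _ cvg_snd cvg_fst).
  have Gc : z.2.2.2 *m z.1 @[z --> (v0, ((0 : 'cV[R]_m), (eta0, Gt)))] --> Gt *m v0.
    apply: cvg_mulmx; last exact: cvg_fst.
    exact: (cvg_comp _ _ (cvg_comp _ _ cvg_snd cvg_snd) cvg_snd).
  by apply: filterS2 (cvgr_neq0 _ Lc Lv0) (cvgr_neq0 _ Gc Gv0) => z /eqP Lz /eqP Gz [].
have [eta1 Jeta1 v0eta1] :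
    exists2 eta, subdiff J (phi 0) eta & dotp v0 (eta0 - eta) < 0.
  apply: contrapT => H; apply: nTv0; apply: (relint_normal eta0_ri) => eta Jeta.
  by rewrite leNgt; apply/negP => v0eta; apply: H; exists eta.
have dc : dotp z.1.1 (z.1.2 - z.2) @[z --> ((v0, eta0), eta1)]
    --> dotp v0 (eta0 - eta1).
  apply: cvg_dotp; first exact: (cvg_comp _ _ cvg_fst cvg_fst).
  apply: cvgB; last exact: cvg_snd.
  exact: (cvg_comp _ _ cvg_fst cvg_snd).
have [[P Q] /= [Pn Qn] PQ] := cvgr_lt _ dc _ v0eta1.
have hQ : \forall h \near (0 : 'cV[R]_m), (subdiff J (phi h) `&` Q) !=set0.
  apply: (phi_within (fun x => (subdiff J x `&` Q) !=set0)).
  exact: (J_inner Jeta1 Qn).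
have ac : (z.1, z.2.2.1) @[z --> (v0, ((0 : 'cV[R]_m), (eta0, Gt)))] --> (v0, eta0).
  apply: (cvg_pair (F := nbhs (v0, ((0 : 'cV[R]_m), (eta0, Gt))))
    (G := nbhs v0) (H := nbhs eta0)).
    exact: cvg_fst.
  exact: (cvg_comp _ _ (cvg_comp _ _ cvg_snd cvg_snd) cvg_fst).
have hc : z.2.1 @[z --> (v0, ((0 : 'cV[R]_m), (eta0, Gt)))] --> (0 : 'cV[R]_m).
  exact: (cvg_comp _ _ cvg_snd cvg_fst).
have acP : \forall z \near (v0, ((0 : 'cV[R]_m), (eta0, Gt))), P (z.1, z.2.2.1).
  exact: ac Pn.
have hcQ : \forall z \near (v0, ((0 : 'cV[R]_m), (eta0, Gt))),
    (subdiff J (phi z.2.1) `&` Q) !=set0.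
  exact: hc hQ.
apply: filterS2 acP hcQ => z Pz [eta [Jeta Qeta]] _; exists eta => //.
by apply: (PQ ((z.1, z.2.2.1), eta)).
Qed.

End Transversal.

End Subgradients.

(** * Estimates uniform in the data, by compactness *)

Section UniformEstimates.
Context {R : realType}.

(** The vector [z.2] will be the remainder of [phi], so that the quadratic term is controlled along
    the manifold and not only along its tangent space. *)
Lemma uniform_coercivity p m (Gt : 'M[R]_p) (L : 'M[R]_(p, m)) :
  (forall k : 'cV_m, k != 0 -> 0 < dotp (Gt *m (L *m k)) (L *m k)) ->
  exists2 c : R, 0 < c & \forall z \near (Gt, (0 : 'cV[R]_p)), forall h, `|h| = 1 ->
    c < dotp (z.1 *m (L *m h + z.2)) (L *m h + z.2).
Proof.
move=> Gpos.
(* The bound [c] is treated as one more parameter, tending to 0 from the right; a single compactness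
   argument then gives both [c] and the neighbourhood. *)
pose F := filter_prod (0 : R)^'+ (nbhs (Gt, (0 : 'cV[R]_p))).
have FF : Filter F by exact: filter_prod_filter.
have : \forall z \near F, forall h, `|h| = 1 ->
    z.1 < dotp (z.2.1 *m (L *m h + z.2.2)) (L *m h + z.2.2).
  apply: (@compact_near _ _ F _ _ _
    (fun z h => z.1 < dotp (z.2.1 *m (L *m h + z.2.2)) (L *m h + z.2.2))
    (@compact_cV_sphere _ m)) => h /= h1.
  have h0 : h != 0 by rewrite -normr_eq0 h1 oner_neq0.
  have Lc : (L *m z.1 + z.2.2.2) @[z --> filter_prod (nbhs h) F] --> L *m h.
    rewrite -[X in _ --> X]addr0; apply: cvgD.
      by apply: cvg_mulmx; [exact: cvg_cst|exact: cvg_fst].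
    exact: (cvg_comp _ _ (cvg_comp _ _ cvg_snd cvg_snd) cvg_snd).
  have Gc : z.2.2.1 @[z --> filter_prod (nbhs h) F] --> Gt.
    exact: (cvg_comp _ _ (cvg_comp _ _ cvg_snd cvg_snd) cvg_fst).
  have c0 : z.2.1 @[z --> filter_prod (nbhs h) F] --> (0 : R).
    have id0 : (fun t : R => t) t @[t --> (0 : R)^'+] --> (0 : R) by exact: cvg_within.
    exact: (cvg_comp _ _ (cvg_comp _ _ cvg_snd cvg_fst) id0).
  have dc : dotp (z.2.2.1 *m (L *m z.1 + z.2.2.2)) (L *m z.1 + z.2.2.2) - z.2.1
      @[z --> filter_prod (nbhs h) F] --> dotp (Gt *m (L *m h)) (L *m h) - 0.
    by apply: cvgB c0; exact: (cvg_dotp (cvg_mulmx Gc Lc) Lc).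
  rewrite subr0 in dc; have dpos := cvgr_gt _ dc _ (Gpos _ h0).
  near=> z; rewrite -subr_gt0 /=; near: z; exact: dpos.
case=> -[P Q] /= [Pn Qn] PQ.
have [c [c0 Pc]] : exists c : R, 0 < c /\ P c.
  exact: (filter_ex (filterI (nbhs_right_gt (0 : R)) Pn)).
exists c => //; apply: filterS Qn => z Qz.
by apply: (PQ (c, z)).
Unshelve. all: by end_near. Qed.

(** At [w = mu^-1 *: h] this is [zeta - mu^-1 *: (G *m (phi h - phi 0))], the candidate subgradient
    at [phi h]. Keeping [w] apart from [h] lets [h] tend to 0 while [w] only stays in a ball. *)
Definition multiplier p m (phi : 'cV[R]_m -> 'cV[R]_p) h (zeta : 'cV[R]_p)
    (G : 'M[R]_p) (w : 'cV[R]_m) : 'cV[R]_p :=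
  zeta - G *m (jac phi 0 *m w + `|w| *: remainder phi h).

(** At each [w0] of the ball, either the limit equation holds and the multiplier tends to [eta0], or
    it fails and by continuity the premise fails nearby. *)
Lemma multiplier_near p m (phi : 'cV[R]_m -> 'cV[R]_p) (g : 'cV[R]_m -> 'cV[R]_m)
    (Gt : 'M[R]_p) (eta0 : 'cV[R]_p) (K delta : R) :
  C1_at phi -> {for 0, continuous g} ->
  (forall k, (jac phi 0)^T *m - (Gt *m (jac phi 0 *m k)) = g 0 ->
     - (Gt *m (jac phi 0 *m k)) = eta0) ->
  0 < delta ->
  \forall z \near ((0 : 'cV[R]_m), ((0 : 'cV[R]_p), Gt)), forall w, `|w| <= K ->
    (jac phi z.1)^T *m multiplier phi z.1 z.2.1 z.2.2 w = g z.1 ->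
    `|multiplier phi z.1 z.2.1 z.2.2 w - eta0| < delta.
Proof.
move=> phi_C1 g_cont eta0E delta0.
pose F := nbhs ((0 : 'cV[R]_m), ((0 : 'cV[R]_p), Gt)).
have FF : Filter F by exact: nbhs_filter.
apply: (@compact_near _ _ F _ _ _
  (fun z w => (jac phi z.1)^T *m multiplier phi z.1 z.2.1 z.2.2 w = g z.1 ->
    `|multiplier phi z.1 z.2.1 z.2.2 w - eta0| < delta)
  (@compact_cV_closed_ball _ m K)) => w0 /= _.
have wc : z.1 @[z --> filter_prod (nbhs w0) F] --> w0 by exact: cvg_fst.
have hc : z.2.1 @[z --> filter_prod (nbhs w0) F] --> (0 : 'cV[R]_m).
  exact: (cvg_comp _ _ cvg_snd cvg_fst).
have zc : z.2.2.1 @[z --> filter_prod (nbhs w0) F] --> (0 : 'cV[R]_p).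
  exact: (cvg_comp _ _ (cvg_comp _ _ cvg_snd cvg_snd) cvg_fst).
have Gc : z.2.2.2 @[z --> filter_prod (nbhs w0) F] --> Gt.
  exact: (cvg_comp _ _ (cvg_comp _ _ cvg_snd cvg_snd) cvg_snd).
have Ec : multiplier phi z.2.1 z.2.2.1 z.2.2.2 z.1
    @[z --> filter_prod (nbhs w0) F] --> - (Gt *m (jac phi 0 *m w0)).
  rewrite -[X in _ --> X]add0r; apply: (cvgB zc); apply: (cvg_mulmx Gc).
  rewrite -[X in _ --> X]addr0; apply: cvgD.
    by apply: cvg_mulmx; [exact: cvg_cst|exact: wc].
  rewrite -(scaler0 _ `|w0|); apply: cvgZ; first exact: cvg_norm.
  exact: (cvg_comp _ _ hc (C1_remainder_cvg phi_C1)).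
have gc : g z.2.1 @[z --> filter_prod (nbhs w0) F] --> g 0.
  exact: (cvg_comp _ _ hc g_cont).
have Lc : (jac phi z.2.1)^T *m multiplier phi z.2.1 z.2.2.1 z.2.2.2 z.1 - g z.2.1
    @[z --> filter_prod (nbhs w0) F] -->
    (jac phi 0)^T *m - (Gt *m (jac phi 0 *m w0)) - g 0.
  apply: cvgB gc; apply: cvg_mulmx Ec; apply: cvg_trmx.
  exact: (cvg_comp _ _ hc (C1_jac_cvg phi_C1)).
have [/subr0_eq/eta0E E0|E0] :=
    eqVneq ((jac phi 0)^T *m - (Gt *m (jac phi 0 *m w0)) - g 0) 0.
  rewrite E0 in Ec; have Ed := (cvgrPdistC_lt _ _).1 Ec _ delta0.
  by near=> z => _; near: z; exact: Ed.
have En := cvgr_neq0 _ Lc E0.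
near=> z => E; exfalso.
have /eqP : (jac phi z.2.1)^T *m multiplier phi z.2.1 z.2.2.1 z.2.2.2 z.1
    - g z.2.1 != 0 by near: z; exact: En.
by rewrite E subrr.
Unshelve. all: by end_near. Qed.

(** The quadratic term is of second order in [t] and drops out of the difference quotient, whatever
    [b] is; the two signs of [t] give the two inequalities between the slopes. *)
Lemma first_order p m (J : 'cV[R]_p -> R) (phi : 'cV[R]_m -> 'cV[R]_p)
    (h v : 'cV[R]_m) (eta : 'cV[R]_p) (b : R) (G : 'M[R]_p) :
  derivable phi h v -> derivable (J \o phi : 'cV[R]_m -> R^o) h v ->
  (\forall t \near (0 : R), 0 <= J (phi (t *: v + h)) - J (phi h)
     - dotp eta (phi (t *: v + h) - phi h)
     + b * dotp (G *m (phi (t *: v + h) - phi h)) (phi (t *: v + h) - phi h)) ->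
  'D_v (J \o phi : 'cV[R]_m -> R^o) h = dotp eta ('D_v phi h).
Proof.
rewrite /derivable /derive; set qp := (fun t : R => _); set qJ := (fun t : R => _).
set d := lim _; set a := lim _ => cp cJ kge0.
pose k t := qJ t - dotp eta (qp t) + b * (t * dotp (G *m qp t) (qp t)).
have id0 : (fun t : R => t) t @[t --> (0 : R)^'] --> (0 : R) by exact: cvg_within.
have cJ' : (qJ t : R) @[t --> (0 : R)^'] --> (a : R) by exact: cJ.
have cp' : qp t @[t --> (0 : R)^'] --> d by exact: cp.
have kc : k t @[t --> (0 : R)^'] --> a - dotp eta d + b * (0 * dotp (G *m d) d).
  apply: cvgD.
    by apply: (cvgB cJ'); apply: cvg_dotp (cp'); exact: cvg_cst.
  apply: cvgMl_tmp; apply: (cvgM id0); apply: cvg_dotp (cp').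
  by apply: cvg_mulmx (cp'); exact: cvg_cst.
rewrite mul0r mulr0 addr0 in kc.
have kt : \forall t \near (0 : R), t != 0 -> 0 <= t * k t.
  apply: filterS kge0 => t + t0.
  congr (0 <= _); rewrite /k /qJ /qp /= -scalemxAr !dotpZr dotpZl.
  rewrite /GRing.scale /=; field.
  exact: t0.
apply: (@subr0_eq R); apply/eqP; rewrite (@eq_le _ R); apply/andP; split.
  have k' := cvg_dnbhs_at_left kc.
  apply: (ler_cvg_to k' (cvg_cst 0)).
  near=> t; have t0 : t < 0 by near: t; exact: nbhs_left_lt.
  rewrite -(nmulr_rge0 _ t0).
  by apply: (near (cvg_within _ kt) t) => //; rewrite lt_eqF.
have k' := cvg_dnbhs_at_right kc.
apply: (ler_cvg_to (cvg_cst 0) k').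
near=> t; have t0 : 0 < t by near: t; exact: nbhs_right_gt.
by rewrite -(pmulr_rge0 _ t0); apply: (near (cvg_within _ kt) t) => //; rewrite gt_eqF.
Unshelve. all: by end_near. Qed.

End UniformEstimates.

(** * Projections and pseudo-inverses *)

Section Projections.
Context {R : realType}.

Lemma norm_le_dotp m (x : 'cV[R]_m) : `|x| <= 1 + dotp x x.
Proof.
apply: mx_norm_le => [|i j]; first by rewrite addr_ge0 ?dotp_ge0.
have : `|x i j| ^+ 2 <= dotp x x.
  rewrite real_normK ?num_real// ord1 /dotp (bigD1 i)//= expr2 lerDl.
  by apply: sumr_ge0 => k _; rewrite -expr2 sqr_ge0.
by have := normr_ge0 (x i j); nra.
Qed.

Lemma dotp_line m (u w : 'cV[R]_m) t :
  dotp (u - t *: w) (u - t *: w) = dotp u u - 2 * t * dotp u w + t ^+ 2 * dotp w w.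
Proof. by rewrite !dotpL (dotpC w u); ring. Qed.

(** [a] is a point of [S] nearest to [y], and the inequality is the variational characterization of
    the projection. *)
Lemma projection_separation m (S : set 'cV[R]_m) (y : 'cV[R]_m) :
  S !=set0 -> closed S ->
  (forall a b (t : R), S a -> S b -> 0 <= t -> t <= 1 -> S (a + t *: (b - a))) ->
  exists2 a, S a & forall z, S z -> dotp (y - a) (z - a) <= 0.
Proof.
move=> [z0 Sz0] Scl Sconv; pose f (x : 'cV[R]_m) : R := dotp (y - x) (y - x).
have fc : continuous f.
  move=> x; have yc : (y - z) @[z --> x] --> y - x.
    by apply: (@cvgB _ _ _ (nbhs x)); [exact: cvg_cst|exact: cvg_id].
  exact: (cvg_dotp yc yc).
pose K := S `&` [set x | f x <= f z0].
have Kcl : closed K.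
  apply: closedI => //.
  by refine (preimage_closed _ (@closed_le _ (f z0))) => x _; exact: fc.
have Kc : compact K.
  apply: (@cV_bounded_closed_compact _ _ _ (`|y| + (1 + f z0))) Kcl => x [_ /= fx].
  rewrite -[x](subKr y) (le_trans (ler_normB _ _))// lerD2l.
  by rewrite (le_trans (norm_le_dotp _))// lerD2l.
have K0 : K !=set0 by exists z0; split; rewrite ?/=.
have [a] := compact_EVT_min K0 Kc (continuous_subspaceT fc).
move=> /set_mem [Sa fa] amin; exists a => // z Sz.
have fmin x : S x -> f a <= f x.
  move=> Sx; have [fx|/ltW fx] := leP (f x) (f z0); last exact: le_trans fx.
  by apply: amin; rewrite inE.
rewrite leNgt; apply/negP => d0.
set c := dotp (y - a) (z - a) in d0.
have N0 := dotp_ge0 (z - a); set N := dotp (z - a) (z - a) in N0.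
(* With [c > 0] this [t] lies in ]0, 1] and gives [t * N < c], so moving from [a] towards [z] would
   decrease the squared distance to [y]. *)
pose t := c / (c + N).
have cN : 0 < c + N by rewrite ltr_wpDr.
have t0 : 0 < t by rewrite divr_gt0.
have t1 : t <= 1 by rewrite ler_pdivrMr// mul1r lerDl.
have tE : t * (c + N) = c by rewrite divfK// gt_eqF.
have := fmin _ (Sconv _ _ t Sa Sz (ltW t0) t1).
have -> : f (a + t *: (z - a)) = f a - 2 * t * c + t ^+ 2 * N.
  by rewrite /f opprD addrA dotp_line.
clearbody t N c; nra.
Qed.

(** If [y = G *m x] were nonzero, the form at [x - s *: y] would be at most $-2s\langle
    y,y\rangle+s^2\langle Gy,y\rangle$, which is negative for small [s > 0]. *)
Lemma psd_ker m (G : 'M[R]_m) (x : 'cV[R]_m) :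
  G^T = G -> (forall y : 'cV_m, 0 <= dotp (G *m y) y) ->
  dotp (G *m x) x <= 0 -> G *m x = 0.
Proof.
move=> Gs Gp Gx; apply: dotp_eq0; apply/eqP; rewrite eq_le dotp_ge0 andbT.
rewrite leNgt; apply/negP => a0; set y := G *m x in Gx a0 *.
have xGy : dotp (G *m y) x = dotp y y by rewrite dotp_mull Gs.
have c0 := Gp y; set c := dotp (G *m y) y in c0 *.
set a := dotp y y in a0 xGy.
pose s := a / (c + 1); have s0 : 0 < s by rewrite divr_gt0// ltr_wpDl.
have sc : s * (c + 1) = a by rewrite divfK// gt_eqF// ltr_wpDl.
have sa : 0 < s * a by rewrite mulr_gt0.
have := Gp (x - s *: y).
rewrite mulmxBr -scalemxAr -/y dotpBl !dotpBr dotpZl !dotpZr dotpZl xGy -/c -/a.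
clearbody s c a; nra.
Qed.

Lemma eq_mulmx_cV m n (A B : 'M[R]_(m, n)) :
  (forall x : 'cV_n, A *m x = B *m x) -> A = B.
Proof.
move=> AB; apply/matrixP => i j; have := AB (delta_mx j 0).
by rewrite -!colE => /colP /(_ i); rewrite !mxE.
Qed.

(** [A *m B] and [A *m C] are both the orthogonal projection onto the range of [A], and [B *m A] and
    [C *m A] agree likewise. *)
Lemma pseudo_inverse_unique m n (A : 'M[R]_(m, n)) B C :
  is_pseudo_inverse A B -> is_pseudo_inverse A C -> B = C.
Proof.
move=> [ABA BAB ABs BAs] [ACA CAC ACs CAs].
have AB : A *m B = A *m C.
  rewrite -{1}ACA -mulmxA -ACs -ABs -trmx_mul mulmxA ABA.
  by rewrite ACs.
have BA : B *m A = C *m A.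
  transitivity ((B *m A) *m (C *m A)).
    by rewrite mulmxA -[B *m A *m C]mulmxA -mulmxA ACA.
  rewrite -BAs -{1}CAs -trmx_mul mulmxA -[C *m A *m B]mulmxA -mulmxA ABA.
  by rewrite CAs.
by rewrite -BAB -mulmxA AB mulmxA BA CAC.
Qed.

(** The normal equations: [L *m k] is the projection of [x] when [L^T *m x = L^T *m (L *m k)]. *)
Lemma orth_proj_range p m (L : 'M[R]_(p, m)) :
  (forall k : 'cV_m, L *m k = 0 -> k = 0) ->
  orth_proj (range (fun k : 'cV[R]_m => L *m k)) = L *m invmx (L^T *m L) *m L^T.
Proof.
move=> L0; have S := gram_unit L0; set P0 := _ *m L^T.
have LP0 : L^T *m P0 = L^T by rewrite /P0 !mulmxA mulmxV// mul1mx.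
apply: xget_unique => [x|P Pproj].
  split; first by exists (invmx (L^T *m L) *m L^T *m x) => //; rewrite !mulmxA.
  move=> _ [k _ <-]; rewrite dotpC dotpC dotp_mull mulmxBr mulmxA LP0 subrr.
  by rewrite dotp0r.
apply: eq_mulmx_cV => x; have [[k _ kP] Pperp] := Pproj x.
have LP : L^T *m (x - P *m x) = 0.
  apply: dotp_eq0; rewrite {1}dotp_mull trmxK dotpC.
  by apply: Pperp; eexists.
have LE : L^T *m x = L^T *m (L *m k) by apply: subr0_eq; rewrite -mulmxBr kP.
by rewrite -kP /P0 -!mulmxA LE (mulmxA L^T L) mulKmx.
Qed.

(** * The linearized pre-certificate in tangent coordinates *)

Section Precertificate.
Variables (p m : nat) (J : 'cV[R]_p -> R) (x : 'cV[R]_p) (L : 'M[R]_(p, m)).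
Variable Gt : 'M[R]_p.
Hypothesis L0 : forall k : 'cV[R]_m, L *m k = 0 -> k = 0.
Hypothesis H0 : forall k : 'cV[R]_m, L^T *m Gt *m L *m k = 0 -> k = 0.
Hypothesis LT : model_space J x = range (fun k => L *m k).

(** [L *m (L^T *m (eta - eta'))] lies in the model space, hence is orthogonal to [eta - eta']; so
    [L^T *m (eta - eta')] has zero norm. *)
Lemma subdiff_tangent_eq eta eta' :
  subdiff J x eta -> subdiff J x eta' -> L^T *m eta = L^T *m eta'.
Proof.
move=> Je Je'; apply: subr0_eq; rewrite -mulmxBr; apply: dotp_eq0.
rewrite {1}dotp_mull trmxK.
have : model_space J x (L *m (L^T *m (eta - eta'))) by rewrite LT; eexists.
by apply; exists eta, eta', 1; rewrite scale1r.
Qed.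

(** In the coordinates [L *m k] the bilinear form of [Gt] on the tangent space has the invertible
    matrix [H], which gives the pseudo-inverse of the compression of [Gt] explicitly. *)
Lemma precertificateE eta : subdiff J x eta ->
  precertificate J x Gt = Gt *m (L *m (invmx (L^T *m Gt *m L) *m (L^T *m eta))).
Proof.
move=> Je; rewrite /precertificate /model_vector LT orth_proj_range//.
set S := invmx (L^T *m L); set H := L^T *m Gt *m L.
have Su := gram_unit L0; have Hu : H \in unitmx by exact: unitmx_ker0.
have St : (S^T = S)%R by rewrite /S trmx_inv trmx_mul trmxK.
have SL (A : 'M[R]_(m, p)) : L *m S *m L^T *m (L *m A) = L *m A.
  by rewrite !mulmxA -(mulmxA _ L^T L) mulmxKV.
have LS (A : 'M[R]_(p, m)) : A *m L^T *m (L *m S *m L^T) = A *m L^T.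
  by rewrite !mulmxA -[A *m L^T *m L]mulmxA mulmxK.
have -> : xget 0 [set (L *m S *m L^T) *m eta0 | eta0 in subdiff J x] =
    L *m S *m L^T *m eta.
  apply: xget_unique; first by exists eta.
  move=> _ [eta' Je' <-].
  by rewrite -!mulmxA (subdiff_tangent_eq Je Je').
(* The Penrose equations for [X] follow once both its products with [P *m Gt *m P] are seen to be
   the symmetric matrix [P]. *)
pose X := L *m invmx H *m L^T; set P := L *m S *m L^T.
have PE : P^T = P by rewrite /P !trmx_mul trmxK St mulmxA.
have AX : P *m Gt *m P *m X = P.
  rewrite -mulmxA [P *m X](_ : _ = X); last by rewrite /X -mulmxA SL.
  by rewrite /P /X -!mulmxA (mulmxA L^T Gt) (mulmxA (L^T *m Gt)) -/H mulKVmx.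
have XA : X *m (P *m Gt *m P) = P.
  rewrite -[P *m Gt *m P]mulmxA mulmxA [X *m P](_ : _ = X); last by rewrite /X LS.
  by rewrite /P /X -!mulmxA (mulmxA L^T Gt) (mulmxA (L^T *m Gt)) -/H mulKmx.
have -> : pseudo_inverse (P *m Gt *m P) = X.
  have Xinv : is_pseudo_inverse (P *m Gt *m P) X.
    split; rewrite ?AX ?XA ?PE//.
    - by rewrite -[P *m Gt *m P]mulmxA mulmxA [P *m P](_ : _ = P)// /P LS.
    - by rewrite /X -mulmxA SL.
  by apply: xget_unique => // C /pseudo_inverse_unique; apply.
rewrite /X /P -!mulmxA; congr (_ *m (_ *m (_ *m _))).
by rewrite !mulmxA mulmxV// mul1mx.
Qed.

End Precertificate.

End Projections.

(** * First-order conditions in a local parametrization *)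

Section LocalParametrization.
Context {R : realType}.

Lemma near_pair (V1 V2 : normedModType R) (a : V1) (b : V2) (P : V1 * V2 -> Prop) :
  (\forall z \near (a, b), P z) ->
  exists2 e : R, 0 < e & forall x y, `|a - x| < e -> `|b - y| < e -> P (x, y).
Proof.
move=> /nbhs_ballP [e /= e0 eP]; exists e => // x y ax bY.
by apply: eP; split => /=; rewrite -ball_normE.
Qed.

Lemma near_triple (V1 V2 V3 : normedModType R) (a : V1) (b : V2) (c : V3)
    (P : V1 * (V2 * V3) -> Prop) :
  (\forall z \near (a, (b, c)), P z) ->
  exists2 e : R, 0 < e & forall x y z,
    `|a - x| < e -> `|b - y| < e -> `|c - z| < e -> P (x, (y, z)).
Proof.
move=> /nbhs_ballP [e /= e0 eP]; exists e => // x y z ax bY cz.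
by apply: eP; split => /=; last split; rewrite -ball_normE.
Qed.

Lemma jac_tr_mul p m (phi : 'cV[R]_m -> 'cV[R]_p) h eta (j : 'I_m) :
  ((jac phi h)^T *m eta) j 0 = dotp eta ('D_(base_vec j) phi h).
Proof.
by rewrite dotpC mxE; apply: eq_bigr => i _; rewrite !mxE.
Qed.

(* Up to an additive constant, the objective of (P_theta) with theta =
   (mu, G *m x0 + mu *: zeta, G). *)
Definition energy p (J : 'cV[R]_p -> R) (x0 : 'cV[R]_p) (mu : R)
    (zeta : 'cV[R]_p) (G : 'M[R]_p) (x : 'cV[R]_p) : R :=
  J x + (2 * mu)^-1 * dotp (G *m (x - x0)) (x - x0) - dotp zeta (x - x0).

(** The quadratic part is expanded exactly at [x]. For [mu > 0] and [G] positive semidefinite, [x]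
    is thus a minimizer as soon as [zeta - mu^-1 *: (G *m (x - x0))] is a subgradient of [J] at
    [x]. *)
Lemma energy_expand p (J : 'cV[R]_p -> R) x0 mu zeta (G : 'M[R]_p) x y :
  mu != 0 -> G^T = G ->
  energy J x0 mu zeta G y - energy J x0 mu zeta G x =
  J y - J x - dotp (zeta - mu^-1 *: (G *m (x - x0))) (y - x)
  + (2 * mu)^-1 * dotp (G *m (y - x)) (y - x).
Proof.
move=> mu0 Gs; rewrite /energy -[y - x0](subrKA x).
move: (y - x) (x - x0) => u d; rewrite mulmxDr !dotpL.
have -> : dotp (G *m u) d = dotp (G *m d) u by rewrite dotp_mull Gs dotpC.
by field.
Qed.

Section LocalData.
Variables (p m : nat) (J : 'cV[R]_p -> R) (M : set 'cV[R]_p) (x0 : 'cV[R]_p).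
Variables (D : set 'cV[R]_m) (phi : 'cV[R]_m -> 'cV[R]_p).
Hypothesis phiP : local_param M x0 D phi.
Hypothesis JphiC2 : Ck_on 2 D (J \o phi : 'cV[R]_m -> R^o).

Definition gradient_param (h : 'cV[R]_m) : 'cV[R]_m :=
  \col_j 'D_(base_vec j) (J \o phi : 'cV[R]_m -> R^o) h.

(** This serves twice: for a minimizer of the energy along [phi], with [b = (2 * mu)^-1], and for a
    subgradient of [J], with [b = 0]. *)
Lemma multiplier_first_order h eta (b : R) (G : 'M[R]_p) : D h ->
  (forall j, \forall t \near (0 : R), 0 <= J (phi (t *: base_vec j + h)) - J (phi h)
     - dotp eta (phi (t *: base_vec j + h) - phi h)
     + b * dotp (G *m (phi (t *: base_vec j + h) - phi h))
                (phi (t *: base_vec j + h) - phi h)) ->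
  (jac phi h)^T *m eta = gradient_param h.
Proof.
move=> Dh jP; apply/colP => j; rewrite jac_tr_mul mxE.
have [_ _ _ [_ phiC1] _] := phiP; have [dphi _] := phiC1 (base_vec j).
have [_ /(_ (base_vec j)) [dJ _]] := JphiC2.
by rewrite (first_order (dphi _ Dh) (dJ _ Dh) (jP j)).
Qed.

Lemma subgradient_first_order h eta :
  D h -> subdiff J (phi h) eta -> (jac phi h)^T *m eta = gradient_param h.
Proof.
move=> Dh Jeta; apply: (@multiplier_first_order h eta 0 0) => // j.
near=> t; rewrite mul0r addr0.
by have := Jeta (phi (t *: base_vec j + h)); lra.
Unshelve. all: by end_near. Qed.

Lemma gradient_param_cvg : {for 0, continuous gradient_param}.
Proof.
have [_ D0 _ _ _] := phiP; rewrite /prop_for /continuous_at.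
apply: ((@cvg_mxP _ _ (nbhs (0 : 'cV[R]_m)) _ _ _ _ _).2) => j i.
rewrite mxE; under eq_fun do rewrite mxE.
by have [_ /(_ (base_vec j)) [_ [+ _]]] := JphiC2; exact.
Qed.

End LocalData.

End LocalParametrization.

(** * Stability of the model *)

Section ModelStability.
Context {R : realType}.

Section Stability.
Variables (p m : nat) (J : 'cV[R]_p -> R) (M : set 'cV[R]_p) (x0 : 'cV[R]_p).
Variables (D : set 'cV[R]_m) (phi : 'cV[R]_m -> 'cV[R]_p) (Gt : 'M[R]_p).
Hypothesis phiP : local_param M x0 D phi.
Hypothesis JphiC2 : Ck_on 2 D (J \o phi : 'cV[R]_m -> R^o).
Hypothesis tangentE : tangent_space M x0 = model_space J x0.
Hypothesis J_inner : subdiff J x0 `<=` inner_limit (subdiff J) M x0.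
Hypothesis Gt_inj : [set v | Gt *m v = 0] `&` model_space J x0 = [set 0].
Hypothesis Gt_cert : relint (subdiff J x0) (precertificate J x0 Gt).
Hypothesis Gt_sym : Gt^T = Gt.
Hypothesis Gt_psd : forall y : 'cV_p, 0 <= dotp (Gt *m y) y.

Let L := jac phi 0.
Let eta0 := precertificate J x0 Gt.
Let g := gradient_param J phi.

Let L0 : forall k : 'cV_m, L *m k = 0 -> k = 0 := local_param_jac_inj phiP.

Let phi_C1 : C1_at phi.
Proof. by have [oD D0 _ + _] := phiP; exact: Ck_on_C1. Qed.

Let modelE : model_space J x0 = range (fun k : 'cV[R]_m => L *m k).
Proof. by rewrite -tangentE (tangent_space_param phiP). Qed.

Let Gt_inj' v : model_space J x0 v -> Gt *m v = 0 -> v = 0.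
Proof.
by move=> Tv Gv; have : [set 0] v by rewrite -Gt_inj; split.
Qed.

(** By semidefiniteness a vanishing form would put [L *m k] in the kernel of [Gt], which meets the
    tangent space only at 0. *)
Let GtL_pos (k : 'cV_m) : k != 0 -> 0 < dotp (Gt *m (L *m k)) (L *m k).
Proof.
move=> k0; rewrite ltNge; apply: contra_neqN k0 => /(psd_ker Gt_sym Gt_psd).
by move=> GLk; apply/L0/Gt_inj' => //; rewrite modelE; exists k.
Qed.

(** As [g 0 = L^T *m eta0], the limit equation determines [- k] through the invertible matrix
    [L^T *m Gt *m L], and [precertificateE] identifies the outcome. *)
Let eta0E (k : 'cV_m) :
  L^T *m - (Gt *m (L *m k)) = g 0 -> - (Gt *m (L *m k)) = eta0.
Proof.
have [_ D0 phi0 _ _] := phiP; have [Jeta0 _] := Gt_cert.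
have H0 (k' : 'cV_m) : L^T *m Gt *m L *m k' = 0 -> k' = 0.
  move=> Hk; apply/eqP; apply: contraT => /GtL_pos.
  by rewrite dotpC dotp_mull !mulmxA Hk dotp0r ltxx.
have := precertificateE L0 H0 modelE Jeta0.
have -> : L^T *m precertificate J x0 Gt = g 0.
  by apply: (subgradient_first_order phiP JphiC2) => //; rewrite phi0.
move=> eE gE; rewrite /eta0 eE (_ : g 0 = L^T *m Gt *m L *m - k).
  by rewrite mulKmx ?mulmxN//; exact: unitmx_ker0.
by rewrite -gE !mulmxN !mulmxA.
Qed.

Lemma model_consistency :
  exists2 C : R, 0 < C & exists2 K : R, 0 <= K &
    forall (G : 'M[R]_p) (zeta : 'cV[R]_p) (mu : R),
      G^T = G -> (forall y : 'cV_p, 0 <= dotp (G *m y) y) ->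
      0 < mu -> `|G - Gt| <= C -> `|zeta| <= C -> mu <= C ->
      exists xt, [/\ M xt,
        [set x | forall z, energy J x0 mu zeta G x <= energy J x0 mu zeta G z]
          = [set xt] &
        `|xt - x0| <= K * mu].
Proof.
have [oD D0 phi0 [phi_cts _] [_ [U [psi [_ phiD _ _]]]]] := phiP.
have [Jphi_cts _] := JphiC2.
have phi_M h : D h -> M (phi h).
  by move=> Dh; have : (phi @` D) (phi h) by [exists h]; rewrite phiD => -[].
have nD : \forall h \near (0 : 'cV[R]_m), D h by exact: (open_nbhs_nbhs (conj oD D0)).
have nM : \forall h \near (0 : 'cV[R]_m), M (phi h) by exact: filterS nD.
have phi_cont : {for 0, continuous phi} by exact: phi_cts.
have [Jeta0 _] := Gt_cert.
have [eA eA0 sepA] : exists2 e : R, 0 < e & forall h eta G,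
    `|0 - h| < e -> `|eta0 - eta| < e -> `|Gt - G| < e -> forall v, `|v| = 1 ->
    (jac phi h)^T *m v = 0 \/ G *m v = 0 ->
    exists2 eta', subdiff J (phi h) eta' & dotp v (eta - eta') < 0.
  have : \forall z \near ((0 : 'cV[R]_m), (eta0, Gt)), forall v, `|v| = 1 ->
      (jac phi z.1)^T *m v = 0 \/ z.2.2 *m v = 0 ->
      exists2 eta, subdiff J (phi z.1) eta & dotp v (z.2.1 - eta) < 0.
    by apply: (normal_separation (M := M)); rewrite ?phi0//; exact: Gt_inj'.
  by move=> /near_triple [e e0 eP]; exists e => // h eta G; exact: eP.
have [c c0 /near_pair [eB eB0 coerB]] := uniform_coercivity GtL_pos.
(* [W] bounds the pairing of [zeta - eta0] with [L *m k + s] when [k], [s] and [zeta] have norm at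
   most 1; [K2] will bound the minimizer divided by [mu]. *)
pose W := p%:R * (1 + `|eta0|) * (m%:R * `|L| + 1).
have W0 : 0 <= W by rewrite !mulr_ge0 ?addr_ge0 ?mulr_ge0.
pose K2 := 2 * W / c.
have K20 : 0 <= K2 by rewrite !mulr_ge0// invr_ge0 ltW.
(* The accuracy [eA] brings the multiplier of the minimizer within the reach of [sepA]. *)
have [eC eC0 multC] := near_triple (multiplier_near K2 phi_C1
  (gradient_param_cvg phiP JphiC2) eta0E eA0).
have nS : \forall h \near (0 : 'cV[R]_m), `|remainder phi h| < Num.min eB 1.
  have /cvgr0Pnorm_lt := C1_remainder_cvg phi_C1; apply.
  by rewrite lt_min eB0 ltr01.
have nJ : \forall h \near (0 : 'cV[R]_m), subdiff J (phi h) !=set0.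
  have nJM : \forall h \near (0 : 'cV[R]_m),
      M (phi h) -> (subdiff J (phi h) `&` setT) !=set0.
    have nJx : \forall x \near phi 0, M x -> (subdiff J x `&` setT) !=set0.
      by rewrite phi0; exact: (J_inner Jeta0 (@filterT _ (nbhs eta0) _)).
    exact: (phi_cont _ nJx).
  by apply: filterS2 nM nJM => h Mh /(_ Mh) [eta [Jeta _]]; exists eta.
have [e /= e0 eP] := (nbhs_normP _ _).1 (filterI nD (filterI nS nJ)).
pose r := Num.min e (Num.min eA eC) / 2.
have mr0 : 0 < Num.min e (Num.min eA eC) by rewrite !lt_min e0 eA0 eC0.
have r0 : 0 < r by rewrite divr_gt0.
have rlt : [/\ r < e, r < eA & r < eC].
  have : r < Num.min e (Num.min eA eC) by rewrite ltr_pdivrMr// ltr_pMr// ltr1n.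
  by rewrite !lt_min => /and3P.
have [re rA rC] := rlt.
(* The entry [r / (K2 + 1)] forces [K2 * mu < r], which keeps the minimizer off the boundary of the
   ball of radius [r]; halving makes all the inequalities strict. *)
pose C := Num.min (Num.min eA eC) (Num.min eB (Num.min 1 (r / (K2 + 1)))) / 2.
have mC0 : 0 < Num.min (Num.min eA eC) (Num.min eB (Num.min 1 (r / (K2 + 1)))).
  by rewrite !lt_min eA0 eC0 eB0 ltr01 divr_gt0// ltr_wpDl.
have C0 : 0 < C by rewrite divr_gt0.
have : C < Num.min (Num.min eA eC) (Num.min eB (Num.min 1 (r / (K2 + 1)))).
  by rewrite ltr_pdivrMr// ltr_pMr// ltr1n.
rewrite !lt_min => /andP[/andP[CA CC] /and3P[CB C1' CK]].
exists C => //; exists ((m%:R * `|L| + 1) * K2).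
  by rewrite mulr_ge0// addr_ge0// mulr_ge0.
move=> G zeta mu Gs Gp mu0 GC zC muC.
have K2mu : K2 * mu < r.
  rewrite ltr_pdivlMr ?ltr_wpDl// in CK.
  have muK : K2 * mu <= K2 * C by rewrite ler_wpM2l.
  by apply: (le_lt_trans muK); rewrite mulrDr mulr1 in CK; lra.
have rP h : `|h| <= r -> [/\ D h, `|remainder phi h| < eB, `|remainder phi h| < 1 &
    subdiff J (phi h) !=set0].
  move=> hr; have [Dh [+ Jh]] : (D `&` ([set h | `|remainder phi h| < Num.min eB 1] `&`
      [set h | subdiff J (phi h) !=set0])) h.
    by apply: eP; rewrite /= sub0r normrN (le_lt_trans hr).
  by rewrite /= lt_min => /andP[].
pose f := energy J x0 mu zeta G; pose F h := f (phi h).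
have Fc : {within [set h : 'cV[R]_m | `|h| <= r], continuous F}.
  apply: continuous_in_subspaceT => h; rewrite inE /= => /rP [Dh _ _ _].
  have jc : J (phi h') @[h' --> h] --> J (phi h) by exact: (Jphi_cts _ Dh).
  have dc : (phi h' - x0) @[h' --> h] --> phi h - x0.
    by apply: (@cvgB _ _ _ (nbhs h)); [exact: (phi_cts _ Dh)|exact: cvg_cst].
  have qc : dotp (G *m (phi h' - x0)) (phi h' - x0) @[h' --> h] -->
      dotp (G *m (phi h - x0)) (phi h - x0).
    apply: (@cvg_dotp _ _ (nbhs h)) (dc); apply: (@cvg_mulmx _ _ (nbhs h)) (dc).
    exact: cvg_cst.
  have lc : dotp zeta (phi h' - x0) @[h' --> h] --> dotp zeta (phi h - x0).
    by apply: (@cvg_dotp _ _ (nbhs h)) dc; exact: cvg_cst.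
  exact: (cvgB (cvgD jc (cvgMl_tmp qc)) lc).
have [|h /set_mem /= hr hmin] :=
    compact_EVT_min (A := [set h : 'cV[R]_m | `|h| <= r]) _
      (@compact_cV_closed_ball _ _ _) Fc.
  by exists 0; rewrite /= normr0 ltW.
have {}hmin h' : `|h'| <= r -> F h <= F h' by move=> h'r; apply: hmin; rewrite inE.
have [Dh remB rem1 [pi0 Jpi0]] := rP _ hr.
set s := remainder phi h in remB rem1.
have dE : phi h - x0 = L *m h + `|h| *: s.
  by rewrite [phi h]remainderE phi0 addrC addKr.
have zeta1 : `|zeta| <= 1 by rewrite (le_trans zC)// ltW.
(* Comparing [F h] with [F 0] and using the subgradient [eta0] at [x0] bounds the quadratic term by
   a linear one; coercivity then bounds [h]. *)
have h_le : `|h| <= K2 * mu.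
  have [->|h0] := eqVneq h 0; first by rewrite normr0 mulr_ge0// ltW.
  have nh0 : 0 < `|h| by rewrite normr_gt0.
  pose k := `|h|^-1 *: h; have k1 : `|k| = 1.
    by rewrite normrZ normfV normr_id mulVf// gt_eqF.
  have hk : `|h| *: k = h by rewrite scalerA divff ?gt_eqF// scale1r.
  clearbody k; pose y := L *m k + s.
  have dy : phi h - x0 = `|h| *: y.
    by rewrite dE scalerDr scalemxAr hk.
  have : F h <= F 0 by apply: hmin; rewrite normr0 ltW.
  rewrite /F /f /energy phi0 subrr mulmx0 !dotp0r mulr0 addr0 subr0 dy.
  have := Jeta0 (phi h); rewrite -/eta0 dy -scalemxAr !dotpZl !dotpZr => sub Fle.
  have cy : c < dotp (G *m y) y.
    have GB : `|Gt - G| < eB by rewrite distrC (le_lt_trans GC).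
    have sB : `|0 - s| < eB by rewrite sub0r normrN.
    exact: (coerB G s GB sB).
  have yW : dotp zeta y - dotp eta0 y <= W.
    rewrite -dotpBl (le_trans (ler_norm _))// (le_trans (dotp_norm_le _ _))//.
    rewrite /W ler_pM ?mulr_ge0//.
      by rewrite ler_wpM2l// (le_trans (ler_normB _ _))// lerD2r.
    rewrite (le_trans (ler_normD _ _))// lerD// ?(ltW rem1)//.
    by rewrite (le_trans (mulmx_norm_le _ _))// k1 mulr1.
  have Gy : `|h| * (2 * mu)^-1 * dotp (G *m y) y <= W.
    rewrite -(ler_pM2l nh0); nra.
  have : `|h| * c <= 2 * mu * W.
    apply: (@le_trans _ _ (`|h| * dotp (G *m y) y)); first by rewrite ler_wpM2l// ltW.
    rewrite -(ler_pM2l (_ : 0 < (2 * mu)^-1)) ?invr_gt0 ?mulr_gt0//.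
    rewrite mulrA [X in _ <= X]mulKf ?mulf_neq0 ?gt_eqF// [_ * `|h|]mulrC.
    exact: Gy.
  by rewrite /K2 [_ / c * mu]mulrAC ler_pdivlMr// [2 * W * mu]mulrAC.
(* The minimizer is interior to the ball, so small moves along every coordinate direction are
   admissible. *)
have hr' : `|h| < r by exact: le_lt_trans K2mu.
pose eta := zeta - mu^-1 *: (G *m (phi h - x0)).
have mu_neq0 : mu != 0 by rewrite gt_eqF.
have etaE : (jac phi h)^T *m eta = g h.
  apply: (multiplier_first_order phiP JphiC2 (b := (2 * mu)^-1) (G := G)) => // j.
  have tc : (t *: base_vec j + h) @[t --> (0 : R)] --> h.
    rewrite -[X in _ --> X]add0r -(scale0r (base_vec j)).
    by apply: cvgD; [apply: cvgZr_tmp; exact: cvg_id|exact: cvg_cst].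
  have : \forall t \near (0 : R), `|t *: base_vec j + h| < r.
    exact: (cvgr_lt _ (cvg_norm tc) _ hr').
  apply: filterS => t /ltW /hmin; rewrite -subr_ge0 /F /f energy_expand//.
have eta_mult : eta = multiplier phi h zeta G (mu^-1 *: h).
  rewrite /eta /multiplier dE normrZ gtr0_norm ?invr_gt0//.
  by rewrite -scalemxAr -scalerA -scalerDr -scalemxAr.
have eta_near : `|eta0 - eta| < eA.
  rewrite distrC eta_mult; apply: multC.
  - by rewrite sub0r normrN (lt_trans hr').
  - by rewrite sub0r normrN (le_lt_trans zC).
  - by rewrite distrC (le_lt_trans GC).
  - by rewrite normrZ gtr0_norm ?invr_gt0// mulrC ler_pdivrMr.
  - by rewrite -eta_mult.
have sep v : v != 0 -> (jac phi h)^T *m v = 0 \/ G *m v = 0 ->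
    exists2 eta', subdiff J (phi h) eta' & dotp v (eta - eta') < 0.
  move=> v0 vP; have nv0 : 0 < `|v|^-1 by rewrite invr_gt0 normr_gt0.
  have [|||||eta' Jeta' /=] := sepA h eta G _ _ _ (`|v|^-1 *: v).
  - by rewrite sub0r normrN (lt_trans hr').
  - by [].
  - by rewrite distrC (le_lt_trans GC).
  - by rewrite normrZ normfV normr_id mulVf// normr_eq0.
  - by rewrite -!scalemxAr; case: vP => ->; rewrite scaler0; [left|right].
  by rewrite dotpZl pmulr_rlt0// => ?; exists eta'.
(* Otherwise let [pi] be the projection of [eta] on the subdifferential. Both have the same
   tangential component [g h], so [eta - pi] is normal to [M], and [sep] contradicts the variational
   inequality at [pi]. *)
have Jeta : subdiff J (phi h) eta.
  apply: contrapT => nJeta.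
  have [pi Jpi piP] := projection_separation eta
    (ex_intro _ _ Jpi0) (@subdiff_closed _ _ J (phi h)) (@subdiff_convex _ _ J (phi h)).
  have v0 : eta - pi != 0 by rewrite subr_eq0; apply: contra_notN nJeta => /eqP ->.
  have [|eta' Jeta'] := sep _ v0.
    left; rewrite mulmxBr etaE.
    by rewrite (subgradient_first_order phiP JphiC2 Dh Jpi) subrr.
  have -> : dotp (eta - pi) (eta - eta') =
      dotp (eta - pi) (eta - pi) - dotp (eta - pi) (eta' - pi).
    by rewrite -dotpBr opprB addrA subrK.
  by have := piP _ Jeta'; have := dotp_gt0 v0; lra.
have b0 : 0 < (2 * mu)^-1 by rewrite invr_gt0 mulr_gt0.
exists (phi h); split; first exact: phi_M.
- rewrite eqEsubset; split=> [z /= zmin|_ -> /= z]; last first.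
    rewrite -subr_ge0 energy_expand// addr_ge0 ?mulr_ge0 ?(ltW b0)//.
    by have := Jeta z; rewrite -/eta; lra.
  (* For a second minimizer [z], the subgradient gap and the quadratic term are nonnegative with sum
     at most 0. Thus [z - phi h] is in the kernel of [G] and [eta] is exact along it, whereas [sep]
     gives a subgradient of larger slope there. *)
  have zE : J z - J (phi h) - dotp eta (z - phi h) +
      (2 * mu)^-1 * dotp (G *m (z - phi h)) (z - phi h) <= 0.
    by rewrite -energy_expand// subr_le0; exact: zmin.
  apply/eqP; rewrite -subr_eq0; apply: contraT => w0; exfalso.
  have Gw : G *m (z - phi h) = 0.
    apply: psd_ker => //; rewrite -(pmulr_rle0 _ b0).
    by have := Jeta z; lra.
  have [|eta' Jeta'] := sep _ w0; first by right.
  rewrite dotpC dotpBl; have := Jeta' z; rewrite Gw dotp0l mulr0 addr0 in zE.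
  by lra.
- rewrite dE (le_trans (ler_normD _ _))// normrZ normr_id -mulrA.
  rewrite mulrDl mul1r lerD//.
    by rewrite (le_trans (mulmx_norm_le _ _))// ler_wpM2l// mulr_ge0.
  by apply: le_trans _ h_le; rewrite ler_piMr ?(ltW rem1).
Qed.

End Stability.

End ModelStability.

(** * Euclidean and operator norms *)

Section Norms.
Context {R : realType}.

Lemma norm_le_l2norm m (x : 'cV[R]_m) : `|x| <= l2norm x.
Proof.
apply: mx_norm_le => [|i j]; first exact: sqrtr_ge0.
rewrite ord1 -sqrtr_sqr ler_wsqrtr// /dotp (bigD1 i)//= expr2 lerDl.
by apply: sumr_ge0 => k _; rewrite -expr2 sqr_ge0.
Qed.

Lemma l2norm_le_norm m (x : 'cV[R]_m) : l2norm x <= Num.sqrt m%:R * `|x|.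
Proof.
rewrite -[X in _ * X]ger0_norm// -sqrtr_sqr -sqrtrM// ler_wsqrtr//.
by rewrite (le_trans (ler_norm _))// (le_trans (dotp_norm_le _ _))// -mulrA expr2.
Qed.

(** Each entry is a coordinate of the image of a basis vector, which has Euclidean norm 1. *)
Lemma norm_le_opnorm m n (A : 'M[R]_(m, n)) : `|A| <= opnorm A.
Proof.
pose S := [set l2norm (A *m x) | x in [set x | l2norm x <= 1]].
(* Without an upper bound [sup] would be a default value that bounds nothing. *)
have Sub : has_ubound S.
  exists (Num.sqrt m%:R * (n%:R * `|A|)) => _ [x /= x1 <-].
  apply: le_trans (l2norm_le_norm _) _; rewrite ler_wpM2l ?sqrtr_ge0//.
  apply: le_trans (mulmx_norm_le _ _) _; rewrite ler_piMr ?mulr_ge0//.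
  exact: le_trans (norm_le_l2norm x) x1.
have SA x : l2norm x <= 1 -> l2norm (A *m x) <= opnorm A.
  by move=> x1; apply: ub_le_sup => //; exists x.
apply: mx_norm_le => [|i j].
  apply: le_trans (SA 0 _); first exact: sqrtr_ge0.
  by rewrite /l2norm dotp0r sqrtr0.
have ej1 : l2norm (base_vec j : 'cV[R]_n) <= 1.
  rewrite /l2norm /dotp (bigD1 j)//= big1 ?addr0 => [|k kj].
    by rewrite !mxE !eqxx mulr1 sqrtr1.
  by rewrite !mxE (negPf kj) mul0r.
apply: le_trans (SA _ ej1); apply: le_trans (norm_le_l2norm _).
by have := ler_mx_norm_coef (A *m base_vec j) i 0; rewrite -colE mxE.
Qed.

Definition sym_psd m (G : 'M[R]_m) :=
  G^T = G /\ forall y : 'cV_m, 0 <= dotp (G *m y) y.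

(** Used in the contrapositive: a matrix outside this closed cone stays at a positive distance from
    all its elements. *)
Lemma sym_psd_closed m (A : 'M[R]_m) :
  (forall C : R, 0 < C -> exists2 G, sym_psd G & `|G - A| <= C) -> sym_psd A.
Proof.
move=> HA; split=> [|y].
  apply: subr0_eq; apply/eqP; rewrite -normr_eq0 eq_le normr_ge0 andbT.
  apply/ler_addgt0Pl => e e0; rewrite addr0.
  have [|G [Gs _] GA] := HA (e / 2); first by rewrite divr_gt0.
  have -> : A^T - A = (G - A) - (G - A)^T.
    by rewrite linearB /= Gs opprB [RHS]addrC addrA subrK.
  by rewrite (le_trans (ler_normB _ _))// mx_norm_tr; lra.
apply/ler_addgt0Pl => e e0.
pose N := m%:R * (m%:R * `|y|) * `|y|; have N0 : 0 <= N by rewrite !mulr_ge0.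
have [|G [_ Gp] GA] := HA (e / (N + 1)); first by rewrite divr_gt0// ltr_wpDl.
have -> : A *m y = G *m y - (G - A) *m y by rewrite mulmxBl subKr.
rewrite dotpBl addrCA addr_ge0// subr_ge0 (le_trans (ler_norm _))//.
apply: le_trans (dotp_norm_le _ _) _.
have GAy : m%:R * `|(G - A) *m y| * `|y| <= `|G - A| * N.
  have -> : `|G - A| * N = m%:R * (m%:R * `|G - A| * `|y|) * `|y| by rewrite /N; ring.
  by rewrite ler_wpM2r// ler_wpM2l// mulmx_norm_le.
apply: (le_trans GAy); apply: le_trans (ler_wpM2r N0 GA) _.
rewrite mulrAC ler_pdivrMr ?ltr_wpDl// ler_wpM2l ?(ltW e0)//.
by rewrite lerDl.
Qed.

(** Differences cancel the constants, among them the pseudo-inverse term, so both functions have the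
    same minimizers. *)
Lemma objective_energy p (J : 'cV[R]_p -> R) x0 (mu : R) (eps : 'cV[R]_p)
    (G : 'M[R]_p) x z :
  mu != 0 -> G^T = G ->
  objective J mu (G *m x0 + eps) G z - objective J mu (G *m x0 + eps) G x =
  energy J x0 mu (mu^-1 *: eps) G z - energy J x0 mu (mu^-1 *: eps) G x.
Proof.
move=> mu0 Gs.
have GC a b : dotp (G *m a) b = dotp (G *m b) a by rewrite dotp_mull Gs dotpC.
rewrite /objective /energy; move: (dotp (pseudo_inverse G *m _) _) => cst.
rewrite !mulmxBr !dotpL (GC x0 z) (GC x0 x) (dotpC z (G *m x0)) (dotpC x (G *m x0)).
rewrite (GC x0 z) (GC x0 x) (dotpC z eps) (dotpC x eps).
by field.
Qed.

End Norms.

(** The distance to [x0] is first bounded by a multiple of [mu]. In general the penalty biases the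
    solution at order [mu] even without noise, so the rate in [eps] is read in a regime where [mu]
    is at most [kappa] times the norm of [eps]. *)
Theorem theorem1 (R : realType) (p : nat) (J : 'cV[R]_p -> R)
    (x0 : 'cV[R]_p) (M : set 'cV[R]_p) (Gt : 'M[R]_p)
    (J_ge0 : forall x, 0 <= J x)
    (J_convex : convex_function setT J)
    (J_smooth : locally_partly_smooth J M x0)
    (Gt_inj : [set v | Gt *m v = 0] `&` model_space J x0 = [set 0])
    (Gt_cert : relint (subdiff J x0) (precertificate J x0 Gt)) :
  exists2 C : R, 0 < C & forall kappa : R, exists K : R,
    forall (n : nat) (Phi : 'M[R]_(n, p)) (w : 'cV[R]_n) (lambda : R),
      (0 < n)%N -> 0 < lambda ->
      let y := Phi *m x0 + w in
      (exists x, y = Phi *m x) ->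
      let mu := lambda / n%:R in
      let u := n%:R^-1 *: (Phi^T *m y) in
      let G := n%:R^-1 *: (Phi^T *m Phi) in
      let eps := n%:R^-1 *: (Phi^T *m w) in
      Num.max (Num.max (opnorm (G - Gt)) (l2norm eps * mu^-1)) mu <= C ->
      exists xt : 'cV[R]_p,
        [/\ solutions J mu u G = [set xt],
            M xt &
            mu <= kappa * l2norm eps -> l2norm (xt - x0) <= K * l2norm eps].
Proof.
have gram_sym_psd (n : nat) (Phi : 'M[R]_(n, p)) : sym_psd (n%:R^-1 *: (Phi^T *m Phi)).
  split=> [|z]; first by rewrite linearZ /= trmx_mul trmxK.
  by rewrite -scalemxAl dotpZl mulr_ge0 ?invr_ge0// -mulmxA dotp_mull trmxK dotp_ge0.
have [[Gt_sym Gt_psd]|nGt] := pselect (sym_psd Gt); last first.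
  have [C C0 farC] : exists2 C : R, 0 < C & forall G, sym_psd G -> ~ `|G - Gt| <= C.
    apply: contrapT => H; apply: nGt; apply: sym_psd_closed => C C0.
    apply: contrapT => HC; apply: H; exists C => // G Gs GC.
    by apply: HC; exists G.
  exists C => // kappa; exists 0 => n Phi w lambda _ _ y _ mu u G eps.
  rewrite !ge_max => /andP[/andP[GC _] _]; exfalso.
  apply: (farC G (gram_sym_psd n Phi)).
  exact: le_trans (norm_le_opnorm _) GC.
have [Mx0 _ [U nU /(_ x0 Mx0 (nbhs_singleton nU))]] := J_smooth.
move=> [_ [_ [m [D [phi [phiP JphiC2]]]]] tangentE [_ J_inner]].
have [C C0 [K K0 HC]] := model_consistency phiP JphiC2 tangentE J_inner Gt_inj
  Gt_cert Gt_sym Gt_psd.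
(* The factor [kappa] turns the rate in [mu] into one in [eps], and the square root of [p] passes
   from the max norm to the Euclidean norm. *)
exists C => // kappa; exists (Num.sqrt p%:R * (K * kappa)).
move=> n Phi w lambda n0 lambda0 y _ mu u G eps.
rewrite !ge_max => /andP[/andP[GC epsC] muC].
have mu0 : 0 < mu by rewrite divr_gt0// ltr0n.
have mu_neq0 : mu != 0 by rewrite gt_eqF.
have [G_sym G_psd] := gram_sym_psd n Phi; rewrite -/G in G_sym G_psd.
have [|||xt [Mxt solE rate]] := HC G (mu^-1 *: eps) mu G_sym G_psd mu0.
- exact: le_trans (norm_le_opnorm _) GC.
- rewrite normrZ gtr0_norm ?invr_gt0// mulrC (le_trans _ epsC)//.
  by rewrite ler_wpM2r ?norm_le_l2norm// invr_ge0 ltW.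
- exact: muC.
have uE : u = G *m x0 + eps by rewrite /u /y mulmxDr scalerDr mulmxA -scalemxAl.
have objE x z := objective_energy J x0 eps x z mu_neq0 G_sym; rewrite -uE in objE.
exists xt; split => //.
- rewrite -solE; rewrite eqEsubset; split => x /= xP z.
    by rewrite -subr_ge0 -objE subr_ge0.
  by rewrite -subr_ge0 objE subr_ge0.
- move=> mu_le; apply: le_trans (l2norm_le_norm _) _.
  rewrite -mulrA ler_wpM2l ?sqrtr_ge0//.
  by rewrite (le_trans rate)// -mulrA ler_wpM2l.
Qed.
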